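(* Let $\Omega$ be an open set in $\mathbb{R}^n$, and let $f:\Omega\to\mathbb{R}$ be a non-constant locally Lipschitz function on $\Omega$. If the zero set $f^{-1}(0)=\{x\in\Omega: f(x)=0\}$ of $f$ is not empty, then $$\int_{\Omega\setminus f^{-1}(0)}\left|\frac{\nabla f(x)}{f(x)}\right|^{n}\,dx=\infty,$$ or equivalently $$\int_{\Omega\setminus f^{-1}(0)}\bigl|\nabla \log|f(x)|\bigr|^n\,dx=\infty.$$
   Context: The gradient $\nabla f$ of a locally Lipschitz function exists almost everywhere by Rademacher's theorem, and $|\nabla f|^2=f_{x_1}^2+\dots+f_{x_n}^2$ is its squared Euclidean norm.
   Formalization: The formal theorem requires f to be non-constant on the connected component of Ω containing some zero of f (the same as non-constant on Ω if Ω is connected); otherwise the claim fails, e.g. Ω=(0,1)∪(2,3) with f=0 on the first interval and f=1 on the second. *)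

(* Defs.v *)
From HB Require Import structures.
From mathcomp Require Import all_boot all_order all_algebra.
From mathcomp Require Import all_classical all_reals all_analysis.

Set Implicit Arguments.
Unset Strict Implicit.
Unset Printing Implicit Defensive.

Import Order.TTheory GRing.Theory Num.Theory.
Import numFieldNormedType.Exports.

Local Open Scope classical_set_scope.
Local Open Scope ring_scope.

(* The Borel sets of R^n, presented as the product sigma-algebra: the one
   generated by the n coordinate maps, as the library does for n.-tuple. *)
Definition measure_rV_display : measure_display.
Proof. exact. Qed.

Section measurable_rV.
Context {R : realType} (n : nat).

Let coord (i : 'I_n) (v : 'rV[R]_n) : measurableTypeR R := v ord0 i.

Let rV_set0 : g_sigma_preimage coord set0.
Proof. exact: sigma_algebra0. Qed.

Let rV_setC A : g_sigma_preimage coord A -> g_sigma_preimage coord (~` A).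
Proof. exact: sigma_algebraC. Qed.

Let rV_bigcup (F : (set 'rV[R]_n)^nat) :
  (forall i, g_sigma_preimage coord (F i)) ->
  g_sigma_preimage coord (\bigcup_i (F i)).
Proof. exact: sigma_algebra_bigcup. Qed.

HB.instance Definition _ := @isMeasurable.Build measure_rV_display
  'rV[R]_n (g_sigma_preimage coord) rV_set0 rV_setC rV_bigcup.

End measurable_rV.

Section measurable_rV_coord.
Context {R : realType}.

Lemma measurable_coord_rV n (i : 'I_n) :
  measurable_fun [set: 'rV[R]_n] (fun v => v ord0 i : measurableTypeR R).
Proof.
move=> _ Y mY; rewrite setTI; apply: sub_sigma_algebra => /=.
rewrite -bigcup_seq/=; exists i => /=; first by rewrite mem_index_enum.
by exists Y => //; rewrite setTI.
Qed.

Lemma measurable_fun_rV d (T : measurableType d) n (f : T -> 'rV[R]_n) :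
  (forall i, measurable_fun [set: T] (fun x => f x ord0 i : measurableTypeR R)) ->
  measurable_fun [set: T] f.
Proof.
move=> mf; suff sub : g_sigma_preimage
    (fun i x => f x ord0 i : measurableTypeR R) `<=` @measurable _ T.
  move=> _ A mA; apply: sub.
  by rewrite (g_sigma_preimage_comp (fun i (v : 'rV[R]_n) => v ord0 i : measurableTypeR R));
    exists A.
apply: smallest_sub; first exact: sigma_algebra_measurable.
move=> A; rewrite -bigcup_seq => -[i _ [B mB <-]]; exact: mf.
Qed.

Definition rV_cons n (p : measurableTypeR R * 'rV[R]_n) : 'rV[R]_n.+1 :=
  row_mx (p.1%:M : 'rV[R]_1) p.2.

Definition rV_uncons n (v : 'rV[R]_n.+1) : measurableTypeR R * 'rV[R]_n :=
  (v ord0 ord0, \row_i v ord0 (lift ord0 i)).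

Lemma rV_cons0 n (p : measurableTypeR R * 'rV[R]_n) :
  rV_cons p ord0 ord0 = p.1.
Proof.
have -> : ord0 = lshift n (ord0 : 'I_1) :> 'I_n.+1 by exact/val_inj.
by apply: etrans (row_mxEl _ _ _ _) _; rewrite mxE.
Qed.

Lemma rV_consS n (p : measurableTypeR R * 'rV[R]_n) i :
  rV_cons p ord0 (lift ord0 i) = p.2 ord0 i.
Proof.
have -> : lift ord0 i = rshift 1 i :> 'I_n.+1 by exact/val_inj.
exact: row_mxEr.
Qed.

Lemma rV_consK n : cancel (@rV_cons n) (@rV_uncons n).
Proof.
move=> [x v]; rewrite /rV_uncons rV_cons0/=; congr pair.
by apply/rowP => i; rewrite mxE rV_consS.
Qed.

Lemma measurable_rV_cons n : measurable_fun setT (@rV_cons n).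
Proof.
apply: measurable_fun_rV => i; case: (unliftP ord0 i) => [j|] ->.
  under eq_fun do rewrite rV_consS.
  exact: (measurableT_comp (measurable_coord_rV j) measurable_snd).
by under eq_fun do rewrite rV_cons0; exact: measurable_fst.
Qed.

Lemma measurable_rV_uncons n : measurable_fun setT (@rV_uncons n).
Proof.
apply: measurable_fun_pair; first exact: measurable_coord_rV.
apply: measurable_fun_rV => i.
by under eq_fun do rewrite mxE; exact: measurable_coord_rV.
Qed.

End measurable_rV_coord.

Section rV_cons_measure.
Context {R : realType} {n : nat}.
Variable mu : {sigma_finite_measure set 'rV[R]_n -> \bar R}.

Definition rV_cons_measure : set 'rV[R]_n.+1 -> \bar R :=
  pushforward (@lebesgue_measure R \x mu)%E (@rV_cons R n).

Let mcons_preimage A : measurable A -> measurable (@rV_cons R n @^-1` A).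
Proof. by move=> mA; rewrite -[X in measurable X]setTI; exact: measurable_rV_cons. Qed.

Let rV_cons_measure0 : rV_cons_measure set0 = 0%E.
Proof. by rewrite /rV_cons_measure /pushforward preimage_set0 measure0. Qed.

Let rV_cons_measure_ge0 A : (0 <= rV_cons_measure A)%E.
Proof. by rewrite /rV_cons_measure /pushforward measure_ge0. Qed.

Let rV_cons_measure_sigma_additive : semi_sigma_additive rV_cons_measure.
Proof.
move=> F mF tF mUF; rewrite /rV_cons_measure /pushforward preimage_bigcup.
apply: measure_semi_sigma_additive => [i||]; first exact: mcons_preimage.
- apply/trivIsetP => /= i j _ _ ij; rewrite -preimage_setI.
  by move/trivIsetP : tF => /(_ _ _ _ _ ij) ->//; rewrite preimage_set0.
- by rewrite -preimage_bigcup; exact: mcons_preimage.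
Qed.

HB.instance Definition _ := isMeasure.Build _ _ _ rV_cons_measure
  rV_cons_measure0 rV_cons_measure_ge0 rV_cons_measure_sigma_additive.

Let rV_cons_measure_sigma_finite : sigma_finite setT rV_cons_measure.
Proof.
have /sigma_finiteP[F [FT ndF Foo]] := sigma_finiteT (@lebesgue_measure R).
have /sigma_finiteP[G [GT ndG Goo]] := sigma_finiteT mu.
exists (fun k => @rV_uncons R n @^-1` (F k `*` G k)).
  apply/esym/seteqP; split=> // v _.
  have [i _ Fi] : (\bigcup_i F i) (rV_uncons v).1 by rewrite -FT.
  have [j _ Gj] : (\bigcup_j G j) (rV_uncons v).2 by rewrite -GT.
  exists (maxn i j) => //; split.
    by move: Fi; exact/subsetPset/ndF/leq_maxl.
  by move: Gj; exact/subsetPset/ndG/leq_maxr.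
move=> k; have [[mF Fk] [mG Gk]] := (Foo k, Goo k); split.
  rewrite -[X in measurable X]setTI.
  by apply: measurable_rV_uncons => //; exact: measurableX.
rewrite /rV_cons_measure /pushforward -comp_preimage.
rewrite (_ : _ \o _ = id); last by apply/funext => p; exact: rV_consK.
by rewrite preimage_id product_measure1E// lte_mul_pinfty// ge0_fin_numE.
Qed.

HB.instance Definition _ := Measure_isSigmaFinite.Build _ _ _ rV_cons_measure
  rV_cons_measure_sigma_finite.

End rV_cons_measure.

Fixpoint lebesgue_measure_rV {R : realType} (n : nat) :
    {sigma_finite_measure set 'rV[R]_n -> \bar R} :=
  match n with
  | 0 => \d_ (0 : 'rV[R]_0)
  | n'.+1 => rV_cons_measure (lebesgue_measure_rV n')
  end.

Lemma lebesgue_measure_rV_box {R : realType} n (A : 'I_n -> set (measurableTypeR R)) :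
  (forall i, measurable (A i)) ->
  lebesgue_measure_rV n [set v | forall i, A i (v ord0 i)] =
  (\prod_(i < n) lebesgue_measure (A i))%E.
Proof.
elim: n A => [|n IH] A mA.
  rewrite big_ord0 /= diracE mem_set//; first by case.
rewrite big_ord_recl -IH// /= /rV_cons_measure /pushforward -product_measure1E//.
- congr product_measure1; apply/seteqP; split => -[x v] /=.
    move=> Av; split; first by have := Av ord0; rewrite rV_cons0.
    by move=> i; have := Av (lift ord0 i); rewrite rV_consS.
  by move=> [Ax Av] i; case: (unliftP ord0 i) => [j|] ->;
    rewrite ?rV_cons0 ?rV_consS.
- rewrite [X in measurable X](_ : _ =
    \big[setI/setT]_(i < n) ((fun v : 'rV[R]_n => v ord0 i : measurableTypeR R) @^-1`
      A (lift ord0 i))).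
    apply: bigsetI_measurable => i _.
    by rewrite -[X in measurable X]setTI; exact: measurable_coord_rV.
  apply/seteqP; split => v /=; rewrite -bigcap_seq => h.
    by move=> i _; exact: h.
  by move=> i; apply: h; rewrite /= mem_index_enum.
Qed.

(* The norm `|v| of the normed module 'rV[R]_n is the sup norm. *)
Definition euclidean_norm {R : realType} {n : nat} (v : 'rV[R]_n) : R :=
  Num.sqrt (\sum_(i < n) v ord0 i ^+ 2).

(* Wherever a partial derivative fails to exist, the corresponding entry is an
   arbitrary value. *)
Definition grad {R : realType} {n : nat} (f : 'rV[R]_n -> R) (x : 'rV[R]_n) :
    'rV[R]_n :=
  \row_(i < n) 'D_(delta_mx ord0 i) f x.

Definition nonconstant_on {T U : Type} (A : set T) (f : T -> U) : Prop :=
  exists x y, [/\ A x, A y & f x <> f y].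

Definition zero_set {R : realType} {n : nat} (Omega : set 'rV[R]_n)
    (f : 'rV[R]_n -> R) : set 'rV[R]_n :=
  [set x | Omega x /\ f x = 0].

(* Main.v *)
(** Let [z] be a zero of [f] that is a limit of points where [f] does not vanish,
    and let [u = ln |f|].  As [f] is Lipschitz near [z], [u <= ln r + C] on the
    cube of radius [r] about [z], so the averages of [u] over the cubes [Q_k] of
    radius [rho / 2 ^ k] tend to [-oo] at least linearly in [k].  On the other
    hand a Poincare inequality, together with the elementary bound
    [t <= c + c^(1-n) t^n], makes the difference of two consecutive averages at
    most [eta + C_eta * int_(Q_k) |grad u|^n].  If the integral were finite,
    these increments would become arbitrarily small and the averages could only
    decrease at an arbitrarily small linear rate.

    Since the zero set may have positive measure, [u] is replaced by the
    truncations [ln (max |f| tau / tau)], whose partial derivatives are dominated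
    by those of [u].  The Poincare inequality compares two cubes one coordinate
    at a time, so it needs only Tonelli and the fundamental theorem of calculus
    for Lipschitz functions of one variable, not Rademacher's theorem. *)

From HB Require Import structures.
Require Import Defs.
From mathcomp Require Import all_boot all_order all_algebra.
From mathcomp Require Import all_classical all_reals all_analysis.
From mathcomp Require Import measurable_realfun ring lra.

Import Order.TTheory GRing.Theory Num.Theory.
Import numFieldNormedType.Exports.

Local Open Scope classical_set_scope.
Local Open Scope ring_scope.

Set Implicit Arguments.
Unset Strict Implicit.

(** * Lipschitz functions of one real variable *)

Lemma lipschitz_ball_continuous (R : realType) (V : normedModType R) (F : V -> R)
    (z : V) (r L : R) : 0 < r ->
  (forall x y, ball z r x -> ball z r y -> `|F x - F y| <= L * `|x - y|) ->
  {for z, continuous F}.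
Proof.
move=> r0 FL; apply/cvgrPdist_le => e e0.
near=> x.
have zx : ball z r x by near: x; exact: nbhsx_ballx.
rewrite (le_trans (FL _ _ (ballxx z r0) zx))//.
(* The sign of [L] is unknown; [|L| + 1] is positive, so one may divide by it. *)
rewrite (@le_trans _ _ ((`|L| + 1) * `|z - x|))//.
  by rewrite ler_wpM2r// (le_trans (ler_norm _))// lerDl.
rewrite -ler_pdivlMl ?ltr_wpDl// mulrC.
near: x; apply: cvgr_dist_le; first exact: cvg_id.
by rewrite divr_gt0// ltr_wpDl.
Unshelve. all: by end_near. Qed.

Lemma lipschitz_continuous (R : realType) (V : normedModType R) (F : V -> R) (L : R) :
  (forall x y, `|F x - F y| <= L * `|x - y|) -> continuous F.
Proof. by move=> FL x; apply: (@lipschitz_ball_continuous _ _ F x 1 L). Qed.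

Section lipschitz_line.
Context {R : realType}.
Local Notation mu := (@lebesgue_measure R).

(** [W + L x] is nondecreasing, and its Stieltjes measure is at most [2 L] times
    the Lebesgue measure: [h] is the Radon-Nikodym density. *)
Lemma lipschitz_stieltjes_density (W : R -> R) (L a b : R) :
  (forall x y, `|W x - W y| <= L * `|x - y|) -> a < b ->
  exists h : R -> R, mu.-integrable [set: R] (EFin \o h) /\
    forall x y, a <= x -> x <= y -> y <= b ->
      (\int[mu]_(t in `]x, y]) (h t)%:E)%E = (W y + L * y - (W x + L * x))%:E.
Proof.
move=> WL ab.
have L0 : 0 <= L.
  by have := WL 1 0; rewrite subr0 normr1 mulr1; apply: le_trans.
pose G x := W x + L * x.
have ndG : nondecreasing G.
  move=> x y xy; rewrite /G -subr_ge0.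
  have := WL x y; rewrite (ler0_norm (x := x - y)) ?subr_le0// ler_norml => /andP[_].
  by rewrite mulrN mulrBr; lra.
have cG : continuous G.
  move=> x; apply: cvgD; first exact: (lipschitz_continuous (V := R^o)) WL x.
  by apply: cvgM; [exact: cvg_cst|exact: cvg_id].
pose Gc : cumulative R R := HB.pack G (isCumulative.Build R _ R G ndG (right_continuousW cG)).
pose m := lebesgue_stieltjes_measure Gc.
have mE x y : x <= y -> m `]x, y]%classic = (G y - G x)%:E.
  move=> xy; rewrite /m /lebesgue_stieltjes_measure /measure_extension.
  rewrite measurable_mu_extE/=; last exact: is_ocitv.
  by rewrite wlength_itv_bnd.
have mab : (m `]a, b]%classic < +oo)%E by rewrite mE ?ltW// ltry.
(* Radon-Nikodym is applied to a finite measure, hence the restriction to a bounded interval. *)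
pose nu := mfrestr (measurable_itv `]a, b] : measurable (_ : set (measurableTypeR R))) mab.
have GL (A : set R) : ocitv A -> (wlength G A <= (2 * L)%:E * wlength idfun A)%E.
  move/ocitvP => [->|[[x y] /= xy ->]]; first by rewrite !wlength0 mule0.
  rewrite !wlength_itv_bnd ?(ltW xy)// -EFinM lee_fin /G.
  have := WL x y; rewrite (ltr0_norm (x := x - y)) ?subr_lt0// ler_norml => /andP[+ _].
  by rewrite mulrN -mulrA /=; lra.
(* Both measures are infima over covers by half-open intervals, so [GL] transfers from covers to
   null sets. The bound [e / (2 * L + 1)] also makes sense when [L] is zero. *)
have mL A : mu A = 0%E -> m A = 0%E.
  move=> A0; apply/eqP; rewrite eq_le measure_ge0 andbT.
  apply/lee_addgt0Pr => e e0; rewrite add0e.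
  have : (mu A < (e / (2 * L + 1))%:E)%E by rewrite A0 lte_fin divr_gt0//; lra.
  rewrite {1}/mu /lebesgue_measure /lebesgue_stieltjes_measure /measure_extension.
  move=> /ereal_inf_lt[_ [F [mF AF] <-]] Fe.
  apply: (@le_trans _ _ (\sum_(k <oo) wlength G (F k))%E).
    by apply: ereal_inf_lbound; exists F.
  apply: (@le_trans _ _ (\sum_(k <oo) ((2 * L)%:E * wlength idfun (F k)))%E).
    apply: lee_nneseries => k _; first by move=> _; exact: (wlength_ge0 Gc).
    exact/GL/mF.
  rewrite nneseriesZl; last by move=> k _; exact: wlength_ge0.
  apply: (@le_trans _ _ ((2 * L)%:E * (e / (2 * L + 1))%:E)%E).
    by rewrite lee_wpmul2l ?lee_fin ?mulr_ge0// ltW.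
  by rewrite -EFinM lee_fin mulrCA ler_piMr ?(ltW e0)// ler_pdivrMr; lra.
have numu : nu `<< mu.
  move=> A A0 B mB BA.
  rewrite /nu /mfrestr /mrestr; apply/eqP; rewrite eq_le measure_ge0 andbT.
  by rewrite -(mL B (A0 _ mB BA)) le_measure ?inE//; apply: measurableI.
have [h [h0 hfin hint hE]] := radon_nikodym_sigma_finite numu.
exists (fine \o h); split.
  by apply: eq_integrable hint => //= x _; rewrite fineK.
move=> x y ax xy yb; rewrite -/(G x) -/(G y) -mE//.
under eq_integral do rewrite /= fineK//.
rewrite -hE//.
rewrite /nu /mfrestr /mrestr; congr (m _).
apply/seteqP; split => t /=; rewrite !in_itv/=; first by case.
by move=> /andP[xt ty]; rewrite xt ty (le_lt_trans ax xt) (le_trans ty yb).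
Qed.

(** On the interval, [W] differs from a primitive of the density [h] by an affine function of slope
    [- L]. The Lebesgue differentiation behind [FTC1] then yields the derivative almost
    everywhere. *)
Lemma lipschitz_ae_derivative (W : R -> R) (L a b : R) :
  (forall x y, `|W x - W y| <= L * `|x - y|) -> a < b ->
  exists h : R -> R, [/\ mu.-integrable [set: R] (EFin \o h),
    {ae mu, forall x, a < x < b -> 'D_1 W x = h x - L} &
    forall x y, a <= x -> x <= y -> y <= b ->
      (\int[mu]_(t in `]x, y]) (h t)%:E)%E = (W y + L * y - (W x + L * x))%:E].
Proof.
move=> WL ab; have [h [hint hE]] := lipschitz_stieltjes_density WL ab.
exists h; split => //.
have hI y : mu.-integrable `]a, y] (EFin \o h).
  by apply: integrableS hint => //; exact: measurable_itv.
have := FTC1 hI (open_integrable_locally openT hint).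
apply: filterS; first exact: (ae_filter_ringOfSetsType mu).
move=> x; rewrite lte_fin => /[swap] /andP[ax xb] /(_ ax)[dF F'].
set F := (fun _ => _) in dF F'.
have FE y : a < y <= b -> W y = F y + (W a + L * a) - L * y.
  move=> /andP[ay yb]; rewrite /F /Rintegral hE ?lexx ?(ltW ay)//=; lra.
suff D : is_derive x (1:R) W (h x - L) by exact: derive_val.
have FD : is_derive x (1:R) F (h x).
  by split => //; rewrite -F' derive1E.
have : is_derive x (1:R) (fun y => F y + (W a + L * a) - L * y) (h x - L).
  apply: is_derive_eq.
  by rewrite addr0 /GRing.scale/= mulr1.
apply: near_eq_is_derive => //.
near=> y; rewrite -FE//; apply/andP; split; [|apply: ltW]; near: y.
  exact: lt_nbhsr.
exact: lt_nbhsl.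
Unshelve. all: by end_near. Qed.

(** The increment of [W] is the integral of [h - L], which is its derivative almost everywhere. The
    form without subtraction makes sense before the integral is known to be finite. *)
Lemma lipschitz_sub_le_integral (W : R -> R) (L a b : R) :
  (forall x y, `|W x - W y| <= L * `|x - y|) ->
  measurable_fun [set: R] ('D_1 W) ->
  forall x y, x \in `[a, b] -> y \in `[a, b] ->
  ((W x)%:E <= (W y)%:E + \int[mu]_(t in `[a, b]) (`|'D_1 W t|)%:E)%E.
Proof.
move=> WL mD x y xab yab.
have mD' : measurable_fun `[a, b] (fun t => (`|'D_1 W t|)%:E).
  apply/measurable_EFinP; apply: measurableT_comp => //.
  exact: measurable_funS mD.
have [ab|ba] := leP a b; last first.
  by exfalso; move: xab; rewrite in_itv/=; lra.
(* The derivative is identified on an open interval only. Going up to [b + 1] includes the endpoint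
   [b] and covers the case [a = b]. *)
have ab1 : a < b + 1 by lra.
have [h [hint hD hE]] := lipschitz_ae_derivative WL ab1.
have main u v : a <= u -> u <= v -> v <= b ->
    ((`|W v - W u|)%:E <= \int[mu]_(t in `[a, b]) (`|'D_1 W t|)%:E)%E.
  move=> au uv vb.
  have suv : `]u, v] `<=` `[a, b].
    by move=> t /=; rewrite !in_itv/= => /andP[ut tv]; lra.
  have hint' : mu.-integrable `]u, v] (EFin \o h).
    by apply: integrableS hint => //; exact: measurable_itv.
  have muv : mu `]u, v]%classic = (v - u)%:E.
    by rewrite lebesgue_measure_itv/= lte_fin; case: ltgtP uv => // -> _; rewrite subrr.
  have cint : mu.-integrable `]u, v] (EFin \o cst L).
    apply/integrableP; split => /=; first exact: (measurable_cst L%:E).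
    apply: (@le_lt_trans _ _ (`|L|%:E * mu `]u, v])%E); last by rewrite muv -EFinM ltry.
    by rewrite -integral_cst.
  have -> : (`|W v - W u|)%:E = (`| \int[mu]_(t in `]u, v]) (h t - L)%:E |)%E.
    rewrite (_ : (fun t => _) = (fun t => (EFin \o h) t - (EFin \o cst L) t)%E)//.
    rewrite integralB//= [X in (_ - X)%E](integral_cst mu _ L%:E)// hE//; last lra.
    rewrite [X in (_ * X)%E]muv -EFinM -EFinB/=; congr (`| _ |)%:E; ring.
  have mhL : measurable_fun `]u, v] (fun t => (h t - L)%:E).
    apply/measurable_EFinP; apply: measurable_funB => //.
    by apply/measurable_EFinP; case/integrableP: hint'.
  apply: (le_trans (le_abse_integral mu (measurable_itv `]u, v]) mhL)).
  apply: (@le_trans _ _ (\int[mu]_(t in `]u, v]) (`|'D_1 W t|)%:E)%E); last first.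
    by apply: ge0_subset_integral => // t _; rewrite lee_fin.
  apply: ae_ge0_le_integral => //=.
  - exact: (measurableT_comp (@abse_measurable R setT) mhL).
  - exact: measurable_funS mD'.
  - apply: filterS hD; first exact: (ae_filter_ringOfSetsType mu).
    move=> t /= hDt; rewrite in_itv/= => /andP[ut tv].
    by rewrite lee_fin hDt//; lra.
have mxy : ((`|W x - W y|)%:E <= \int[mu]_(t in `[a, b]) (`|'D_1 W t|)%:E)%E.
  move: xab yab; rewrite !in_itv/= => /andP[ax xb] /andP[ay yb].
  by case: (leP x y) => xy; [rewrite distrC; exact: main|apply: main => //; exact: ltW].
rewrite addeC -leeBlDr// -EFinB (le_trans _ mxy)// lee_fin.
exact: ler_norm.
Qed.
End lipschitz_line.

(** * Measurability of directional derivatives *)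

(** Where the limit exists, it is the limit of the sequence of quotients at [m.+1%:R^-1]; elsewhere
    [lim] is the constant [point]. What has to be shown is that the set of convergence is
    measurable. *)
Lemma measurable_lim_dnbhs0 d (T : measurableType d) (R : realType) (q : R -> T -> R) :
  (forall h, h != 0 -> measurable_fun [set: T] (q h)) ->
  (forall x h, h != 0 -> {for h, continuous (q ^~ x)}) ->
  measurable_fun [set: T] (fun x => lim (q h x @[h --> 0^'])).
Proof.
move=> mq cq.
pose E := [set x | cvg (q h x @[h --> 0^'])].
(* All increments are compared with a single one, [m.+2%:R^-1], which lies in the punctured ball of
   radius [m.+1%:R^-1]. *)
pose C k m (p : rat) := [set x | 0 < `|ratr p : R| < m.+1%:R^-1 ->
  `|q m.+2%:R^-1 x - q (ratr p) x| <= k.+1%:R^-1].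
(* Cauchy criterion, restricted to rational increments by continuity of [q ^~ x]. *)
have EC : E = \bigcap_k \bigcup_m \bigcap_p C k m p.
  apply/seteqP; split => x.
    move=> /cvg_ex[l /cvgrPdist_le ql] k _.
    have /ql : (0:R) < k.+1%:R^-1 / 2 by rewrite divr_gt0 ?invr_gt0.
    move=> /nbhs_ballP[e /= e0 eb].
    have [m me] : exists m : nat, m.+1%:R^-1 < e.
      by exists (Num.truncn e^-1); rewrite invf_plt ?posrE// truncnS_gt.
    have near0 h : 0 < `|h| < m.+1%:R^-1 -> `|l - q h x| <= k.+1%:R^-1 / 2.
      move=> /andP[h0 hm]; apply: eb; last by rewrite -normr_gt0.
      by rewrite /ball/= sub0r normrN (lt_trans hm).
    exists m => // p _ pm.
    have h1 : `|l - q m.+2%:R^-1 x| <= k.+1%:R^-1 / 2.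
      apply: near0; rewrite ger0_norm ?invr_ge0// invr_gt0 ltr0n/=.
      by rewrite ltf_pV2 ?posrE// ltr_nat.
    have h2 := near0 _ pm; rewrite (le_trans (ler_distD l _ _))//.
    by rewrite distrC (splitr k.+1%:R^-1) lerD//; rewrite distrC in h1.
  move=> xC; apply/cauchy_cvgP/cauchy_exP => e e0.
  have [k ke] : exists k : nat, k.+1%:R^-1 < e.
    by exists (Num.truncn e^-1); rewrite invf_plt ?posrE// truncnS_gt.
  have [m _ xm] := xC k I.
  exists (q m.+2%:R^-1 x); apply/nbhs_ballP.
  exists m.+1%:R^-1; first by rewrite /= invr_gt0.
  move=> h /=; rewrite /ball/= sub0r normrN => hm h0.
  apply: le_lt_trans ke; rewrite leNgt; apply/negP => kh.
  have /cvgrPdist_lt : {for h, continuous (q ^~ x)} by exact: cq.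
  move=> /(_ (`|q m.+2%:R^-1 x - q h x| - k.+1%:R^-1)); rewrite subr_gt0 => /(_ kh).
  move=> /nbhs_ballP[e1 /= e10 eb].
  (* A rational this close to [h] has nearly the same quotient, is nonzero, and stays in the ball of
     radius [m.+1%:R^-1]. *)
  pose e2 := Num.min e1 (Num.min `|h| (m.+1%:R^-1 - `|h|)).
  have e20 : 0 < e2 by rewrite !lt_min e10 normr_gt0 h0 subr_gt0.
  have : h - e2 < h + e2 by lra.
  move=> /rat_in_itvoo[p]; rewrite in_itv/= => /andP[ph hp].
  have hpd : `|h - ratr p| < e2 by rewrite distrC ltr_distl ph hp.
  have := hpd; rewrite !lt_min => /and3P[d1 d2 d3].
  have p0 : 0 < `|ratr p : R|.
    by have := lerB_dist h (ratr p); lra.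
  have pm : `|ratr p : R| < m.+1%:R^-1.
    have := lerB_dist (ratr p) h; rewrite distrC => ph'.
    by have := le_lt_trans ph' d3; rewrite ltrD2r.
  have := xm p I; rewrite /C/= p0 pm => /(_ isT).
  have := eb _ d1; have := ler_distD (q (ratr p) x) (q m.+2%:R^-1 x) (q h x).
  rewrite (distrC (q h x)) ltrBrDr => t1 t2 t3.
  by have := lt_le_trans t2 (le_trans t1 (lerD t3 (lexx _))); rewrite addrC ltxx.
have mE : measurable E.
  rewrite EC; apply: bigcapT_measurable => k; apply: bigcupT_measurable => m.
  rewrite -[X in measurable X]setCK; apply: measurableC; rewrite setC_bigcap.
  apply: countable_bigcupT_measurable => // p; apply: measurableC.
  have [pm|pm] := boolP (0 < `|ratr p : R| < m.+1%:R^-1); last first.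
    rewrite (_ : C k m p = setT)//; apply/seteqP; split => // x _ /=.
    by move=> pm'; rewrite pm' in pm.
  rewrite (_ : C k m p = [set: T] `&` [set x | `|q m.+2%:R^-1 x - q (ratr p) x| <= k.+1%:R^-1]).
    apply: measurable_fun_le => //; apply: measurableT_comp => //.
    apply: measurable_funB; apply: mq; rewrite ?invr_eq0 ?pnatr_eq0//.
    by case/andP: pm; rewrite normr_gt0.
  by rewrite setTI; apply/seteqP; split => x /=; [apply|move=> + _].
rewrite -(setvU E); apply/(measurable_funU _ (measurableC mE) mE).
split.
  apply: (@eq_measurable_fun _ _ _ _ _ (cst point)); last exact: measurable_cst.
  move=> x; rewrite inE => nE; apply/esym/xgetPN => l ql.
  by apply: nE; apply/cvg_ex; exists l.
apply: (@measurable_fun_cvg _ _ _ _ (fun m x => q m.+1%:R^-1 x)).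
  move=> m; apply: (measurable_funS measurableT) => //.
  by apply: mq; rewrite invr_eq0 pnatr_eq0.
move=> x Ex; apply: (@cvg_comp _ _ _ (fun m => m.+1%:R^-1) (q ^~ x) _ 0^'); last exact: Ex.
move=> A /nbhs_ballP[e /= e0 eA].
have := @cvg_harmonic R; move/cvgrPdist_lt => /(_ _ e0); apply: filterS => m /= me.
by apply: eA => //; rewrite invr_eq0 pnatr_eq0.
Qed.

(** Measurability lives on [T] and differentiation on [V]; [g] links the two, so that real numbers
    and row vectors are both covered. *)
Lemma measurable_derive d (T : measurableType d) (R : realType) (V : normedModType R)
    (g : T -> V) (F : V -> R) (v : V) :
  continuous F ->
  (forall u, measurable_fun [set: T] (fun x => F (u + g x))) ->
  measurable_fun [set: T] (fun x => 'D_v F (g x)).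
Proof.
move=> cF mF.
apply: (@measurable_lim_dnbhs0 _ _ _ (fun h x => h^-1 *: (F (h *: v + g x) - F (g x)))).
  move=> h h0; apply: measurable_funM => //; apply: measurable_funB => //.
  by have := mF 0; under eq_fun do rewrite add0r.
move=> x h h0; apply: cvgM; first exact: cvgV.
apply: cvgB; last exact: cvg_cst.
apply: (@cvg_comp _ _ _ (fun h => h *: v + g x) F); last exact: cF.
by apply: cvgD; [apply: cvgZr_tmp; exact: cvg_id|exact: cvg_cst].
Qed.

Lemma measurable_derive_R (R : realType) (W : R -> R) :
  continuous W -> measurable_fun [set: R] ('D_1 W).
Proof.
move=> cW; apply: (@measurable_derive _ _ R R^o id W 1) => // u.
apply: continuous_measurable_fun => x.
apply: (@continuous_comp _ _ _ (fun x => u + x) W); last exact: cW.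
by apply: cvgD; [exact: cvg_cst|exact: cvg_id].
Qed.

(** An open set is the countable union of the balls it contains with rational centre and radius
    [m.+1%:R^-1]; a ball of the sup norm is a product of intervals. *)
Lemma open_measurable_rV (R : realType) n (U : set 'rV[R]_n) : open U -> measurable U.
Proof.
move=> oU.
pose B (i : 'rV[rat]_n * nat) : set 'rV[R]_n := ball (map_mx ratr i.1 : 'rV[R]_n) i.2.+1%:R^-1.
have mB i : measurable (B i).
  rewrite (_ : B i = \big[setI/setT]_(j < n)
      ((fun v : 'rV[R]_n => v ord0 j : measurableTypeR R) @^-1`
      ball (ratr (i.1 ord0 j) : R) i.2.+1%:R^-1)).
    apply: bigsetI_measurable => j _.
    by rewrite -[X in measurable X]setTI; apply: measurable_coord_rV => //; exact: measurable_ball.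
  rewrite -bigcap_seq; apply/seteqP; split => v /=.
    by move=> [_ Bv] j _; have := Bv ord0 j; rewrite mxE.
  move=> h; split; first by rewrite invr_gt0.
  by move=> a j; rewrite mxE (ord1 a); apply: h; rewrite /= mem_index_enum.
rewrite (_ : U = \bigcup_i (if `[< B i `<=` U >] then B i else set0)); last first.
  apply/seteqP; split => [x Ux|x [i _]]; last by case: asboolP => // BU; exact: BU.
  have /nbhs_ballP[e /= e0 eU] : nbhs x U by exact: open_nbhs_nbhs.
  have [m me] : exists m : nat, m.+1%:R^-1 < e / 2.
    exists (Num.truncn (e / 2)^-1); rewrite invf_plt ?posrE ?divr_gt0//.
    exact: truncnS_gt.
  have q_ j : exists p : rat, `|x ord0 j - ratr p| < m.+1%:R^-1.
    have : x ord0 j - m.+1%:R^-1 < x ord0 j + m.+1%:R^-1.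
      by rewrite ltrD2l gtrN// invr_gt0.
    move=> /rat_in_itvoo[p]; rewrite in_itv/= => /andP[ph hp].
    by exists p; rewrite distrC ltr_distl ph hp.
  have [q qx] := choice q_.
  exists (\row_j q j, m) => //.
  have Bx : B (\row_j q j, m) x.
    split; first by rewrite invr_gt0.
    by move=> a j; rewrite (ord1 a) !mxE /ball/= distrC.
  case: asboolP => // -[] y By; apply: eU; rewrite (splitr e).
  apply: (@ball_triangle _ _ (map_mx ratr (\row_j q j) : 'rV[R]_n)).
    apply: ball_sym; apply: le_ball Bx; exact: ltW.
  by apply: le_ball By; exact: ltW.
apply: countable_bigcupT_measurable; first exact: countableP.
by move=> i; case: ifP.
Qed.

Lemma continuous_measurable_rV (R : realType) n (F : 'rV[R]_n -> R) :
  continuous F -> measurable_fun [set: 'rV[R]_n] F.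
Proof.
move=> /continuousP cF; apply: (measurability _ (RGenOpens.measurableE R)).
move=> _ [_ [a [b ->] <-]]; rewrite setTI; apply: open_measurable_rV.
exact/cF/interval_open.
Qed.

Lemma measurable_derive_rV (R : realType) n (F : 'rV[R]_n -> R) v :
  continuous F -> measurable_fun [set: 'rV[R]_n] ('D_v F).
Proof.
move=> cF; have H := (@measurable_derive _ 'rV[R]_n R 'rV[R]_n id F v cF).
apply: H => u.
apply: continuous_measurable_rV => x.
apply: (@continuous_comp _ _ _ (fun x => u + x) F); last exact: cF.
apply: (@cvgD _ _ _ (nbhs x) _ (cst u) id); [exact: cvg_cst|exact: cvg_id].
Qed.

(** * Tonelli on row vectors, and cubes *)

Local Notation mu := lebesgue_measure_rV.

Section tonelli.
Context {R : realType} (n : nat) (D : set (measurableTypeR R)) (B : set 'rV[R]_n).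
Context (G : 'rV[R]_n.+1 -> \bar R).
Hypotheses (mD : measurable D) (mB : measurable B).
Hypotheses (mG : measurable_fun setT G) (G0 : forall x, (0 <= G x)%E).

Let E : set 'rV[R]_n.+1 := @rV_uncons R n @^-1` (D `*` B).

Let mE : measurable E.
Proof.
rewrite -[X in measurable X]setTI; apply: measurable_rV_uncons => //.
exact: measurableX.
Qed.

Let H := (G \_ E) \o @rV_cons R n.

Let H0 p : (0 <= H p)%E.
Proof. by rewrite /H/= patchE; case: ifP. Qed.

Let mH : measurable_fun setT H.
Proof.
apply: measurableT_comp; last exact: measurable_rV_cons.
by apply/(measurable_restrictT _ mE); exact: measurable_funS mG.
Qed.

Let HE s y : H (s, y) = if s \in D then ((fun y => G (rV_cons (s, y))) \_ B) y else 0%E.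
Proof.
rewrite /H/= !patchE.
have -> : (rV_cons (s, y) \in E) = (s \in D) && (y \in B).
  rewrite -(in_setX (s, y) D B) -[in RHS](rV_consK (s, y)).
  by apply/idP/idP; rewrite !in_setE.
by case: (s \in D).
Qed.

(** [mu n.+1] is by construction the pushforward of a product measure under [rV_cons]. Extending [G]
    by zero outside [E] puts the integral in the form that Tonelli takes. *)
Let integralE_rV : (\int[mu n.+1]_(x in E) G x = \int[lebesgue_measure \x mu n]_p H p)%E.
Proof.
rewrite integral_mkcond.
have := @ge0_integral_pushforward _ _ _ _ _ _ (@measurable_rV_cons R n)
  (@lebesgue_measure R \x mu n)%E setT (G \_ E) measurableT.
rewrite preimage_setT; apply.
  by apply/(measurable_restrictT _ mE); exact: measurable_funS mG.
by move=> x _; rewrite patchE; case: ifP.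
Qed.

Lemma integral_rV_cons :
  (\int[mu n.+1]_(x in E) G x =
   \int[lebesgue_measure]_(s in D) \int[mu n]_(y in B) G (rV_cons (s, y)))%E.
Proof.
rewrite integralE_rV fubini_tonelli1// [RHS]integral_mkcond.
apply: eq_integral => s _; rewrite /fubini_F patchE.
under eq_integral do rewrite HE.
case: ifP => _; first by rewrite -integral_mkcond.
exact: integral0.
Qed.

Lemma integral_rV_cons_swap :
  (\int[mu n.+1]_(x in E) G x =
   \int[mu n]_(y in B) \int[lebesgue_measure]_(s in D) G (rV_cons (s, y)))%E.
Proof.
rewrite integralE_rV fubini_tonelli2// [RHS]integral_mkcond.
apply: eq_integral => y _; rewrite /fubini_G patchE.
under eq_integral do rewrite HE.
rewrite (_ : (fun s => _) = if y \in B then (fun s => G (rV_cons (s, y))) \_ D else cst 0%E).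
  by case: ifP => _; [rewrite -integral_mkcond|exact: integral0].
apply/funext => s; rewrite patchE.
by case: (y \in B); case: ifPn => sD; rewrite /= ?patchE ?sD ?(negbTE sD).
Qed.

Lemma measurable_inner_integral_rV :
  measurable_fun D (fun s => \int[mu n]_(y in B) G (rV_cons (s, y)))%E.
Proof.
have : measurable_fun D (fubini_F (mu n) H).
  by apply: measurable_funTS; exact: measurable_fun_fubini_tonelli_F.
apply: eq_measurable_fun => s sD; rewrite /fubini_F.
by under eq_integral do rewrite HE sD; rewrite -integral_mkcond.
Qed.

Lemma measurable_inner_integral_rV_swap :
  measurable_fun B (fun y => \int[lebesgue_measure]_(s in D) G (rV_cons (s, y)))%E.
Proof.
have : measurable_fun B (fubini_G (@lebesgue_measure R) H).
  by apply: measurable_funTS; exact: measurable_fun_fubini_tonelli_G.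
apply: eq_measurable_fun => y yB; rewrite /fubini_G.
under eq_integral do rewrite HE patchE yB.
rewrite [RHS]integral_mkcond; apply: eq_integral => s _.
by rewrite patchE.
Qed.

End tonelli.

Section cube.
Context {R : realType}.

(** For [0 <= r] this is the closed ball of the sup norm; the coordinatewise form splits off the
    first coordinate in [cubeS]. *)
Definition cube n (c : 'rV[R]_n) (r : R) : set 'rV[R]_n :=
  [set x | forall i, `|x ord0 i - c ord0 i| <= r].

Definition rV_tail n (c : 'rV[R]_n.+1) : 'rV[R]_n := (rV_uncons c).2.

Lemma measurable_cube n (c : 'rV[R]_n) r : measurable (cube c r).
Proof.
rewrite (_ : cube c r = \big[setI/setT]_(j < n)
      ((fun v : 'rV[R]_n => v ord0 j : measurableTypeR R) @^-1`
      `[c ord0 j - r, c ord0 j + r])).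
  apply: bigsetI_measurable => j _.
  by rewrite -[X in measurable X]setTI; apply: measurable_coord_rV => //; exact: measurable_itv.
rewrite -bigcap_seq; apply/seteqP; split => v /= h.
  by move=> j _; rewrite /= in_itv/= -ler_distl.
by move=> j; have := h j; rewrite /= mem_index_enum => /(_ isT); rewrite in_itv/= -ler_distl.
Qed.

Lemma lebesgue_measure_cube n (c : 'rV[R]_n) r : 0 <= r ->
  mu n (cube c r) = ((2 * r) ^+ n)%:E.
Proof.
move=> r0.
pose A i : set (measurableTypeR R) := `[c ord0 i - r, c ord0 i + r]%classic.
have -> : cube c r = [set v | forall i, A i (v ord0 i)].
  by apply/seteqP; split => v /= h i; have := h i; rewrite /A /= in_itv/= -ler_distl.
have mA i : measurable (A i) by exact: measurable_itv.
rewrite [LHS](lebesgue_measure_rV_box mA).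
rewrite (eq_bigr (fun=> (2 * r)%:E)).
  by rewrite prodEFin prodr_const card_ord.
move=> i _; rewrite lebesgue_measure_itv/= lte_fin -EFinB.
case: ltP => h; congr EFin; lra.
Qed.

Lemma cubeS n (c : 'rV[R]_n.+1) r :
  cube c r = @rV_uncons R n @^-1` (`[c ord0 ord0 - r, c ord0 ord0 + r] `*` cube (rV_tail c) r).
Proof.
apply/seteqP; split => v /=.
  move=> h; rewrite in_itv/= -ler_distl; split; first exact: h.
  by move=> i; rewrite !mxE; exact: h.
move=> [+ h]; rewrite in_itv/= -ler_distl => h0 i.
case: (unliftP ord0 i) => [j|] -> //.
by have := h j; rewrite !mxE.
Qed.

Lemma sub_cube n (c c' : 'rV[R]_n) r r' :
  (forall i, `|c ord0 i - c' ord0 i| <= r' - r) -> cube c r `<=` cube c' r'.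
Proof.
move=> cc x cx i; rewrite (le_trans (ler_distD (c ord0 i) _ _))//.
by have := cc i; have := cx i; lra.
Qed.
End cube.

(** * Comparing averages over cubes *)

Section mean.
Local Open Scope ereal_scope.
Context d (T : measurableType d) (R : realType) (m : {measure set T -> \bar R}).
Variables (A : set T) (v : R).
Hypotheses (mA : measurable A) (mv : m A = v%:E) (v0 : (0 < v)%R).

(** An infinite [k] is allowed: [interval_mean_le] uses it for an integral not known to be
    finite. *)
Lemma mean_cst (k : \bar R) : (v^-1)%:E * \int[m]_(x in A) k = k.
Proof.
rewrite [X in _ * X](integral_cst m mA) [X in _ * (_ * X)]mv muleCA -EFinM.
by rewrite mulVf ?gt_eqF// mule1.
Qed.

Lemma le_mean (f g : T -> \bar R) :
  measurable_fun A f -> measurable_fun A g ->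
  (forall x, A x -> 0 <= f x) -> (forall x, A x -> f x <= g x) ->
  (v^-1)%:E * \int[m]_(x in A) f x <= (v^-1)%:E * \int[m]_(x in A) g x.
Proof.
move=> mf mg f0 fg; apply: lee_wpmul2l; first by rewrite lee_fin invr_ge0 ltW.
by apply: ge0_le_integral.
Qed.

Lemma meanD (f g : T -> \bar R) :
  measurable_fun A f -> measurable_fun A g ->
  (forall x, A x -> 0 <= f x) -> (forall x, A x -> 0 <= g x) ->
  (v^-1)%:E * \int[m]_(x in A) (f x + g x) =
  (v^-1)%:E * \int[m]_(x in A) f x + (v^-1)%:E * \int[m]_(x in A) g x.
Proof.
move=> mf mg f0 g0; rewrite ge0_integralD// ge0_muleDr//; exact: integral_ge0.
Qed.

Lemma mean_le_cst (f : T -> \bar R) k :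
  measurable_fun A f -> (forall x, A x -> 0 <= f x) ->
  (forall x, A x -> f x <= k) -> (v^-1)%:E * \int[m]_(x in A) f x <= k.
Proof.
by move=> mf f0 fk; rewrite -[leRHS]mean_cst le_mean//; exact: measurable_cst.
Qed.

Lemma cst_le_mean (f : T -> \bar R) k :
  measurable_fun A f -> 0 <= k ->
  (forall x, A x -> k <= f x) -> k <= (v^-1)%:E * \int[m]_(x in A) f x.
Proof.
by move=> mf k0 kf; rewrite -[leLHS]mean_cst le_mean//; exact: measurable_cst.
Qed.

End mean.

(** * Sup norm and slices of row vectors *)

Section rV_norm.
Context {R : realType} {n : nat}.
Implicit Types x : 'rV[R]_n.

Lemma ler_coord_norm x i : `|x ord0 i| <= `|x|.
Proof. by rewrite [leRHS]mx_normrE; exact: (le_bigmax _ _ (ord0, i)). Qed.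

Lemma rV_norm_le x r : 0 <= r -> (forall i, `|x ord0 i| <= r) -> `|x| <= r.
Proof.
move=> r0 xr; rewrite [leLHS]mx_normrE; apply: bigmax_le => // -[a i] _ /=.
by rewrite (ord1 a).
Qed.
End rV_norm.

Section slices.
Context {R : realType} {n : nat}.
Implicit Types (w : 'rV[R]_n.+1 -> R) (y : 'rV[R]_n) (s : measurableTypeR R).

Lemma lipschitz_slice_tail w L s :
  0 <= L -> (forall x x', `|w x - w x'| <= L * `|x - x'|) ->
  forall y y', `|w (rV_cons (s, y)) - w (rV_cons (s, y'))| <= L * `|y - y'|.
Proof.
move=> L0 wL y y'; apply: (le_trans (wL _ _)).
rewrite ler_wpM2l// rV_norm_le// => i; rewrite mxE [X in _ + X]mxE.
case: (unliftP ord0 i) => [j|] ->; last by rewrite !rV_cons0 subrr normr0.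
by rewrite !rV_consS (le_trans _ (ler_coord_norm _ j))// mxE [X in _ <= `|_ + X|]mxE.
Qed.

Lemma lipschitz_slice_head w L y :
  0 <= L -> (forall x x', `|w x - w x'| <= L * `|x - x'|) ->
  forall s s', `|w (rV_cons (s, y)) - w (rV_cons (s', y))| <= L * `|(s : R) - s'|.
Proof.
move=> L0 wL s s'; apply: (le_trans (wL _ _)).
rewrite ler_wpM2l// rV_norm_le// => i; rewrite mxE [X in _ + X]mxE.
by case: (unliftP ord0 i) => [j|] ->; rewrite ?rV_cons0 ?rV_consS// subrr normr0.
Qed.

Lemma derive_slice_tail w s y i :
  'D_(delta_mx ord0 (lift ord0 i)) w (rV_cons (s, y)) =
  'D_(delta_mx ord0 i) (fun y => w (rV_cons (s, y))) y.
Proof.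
rewrite /derive; apply: (congr1 (fun g => lim (g h @[h --> 0^']))).
apply/funext => h /=; congr (_ *: (w _ - _)).
apply/rowP => j; rewrite mxE [X in X + _]mxE [X in _ * X + _]mxE.
case: (unliftP ord0 j) => [k|] ->.
  by rewrite !rV_consS !mxE /= (inj_eq lift_inj).
by rewrite !rV_cons0/= mulr0 add0r.
Qed.

Lemma derive_slice_head w s y :
  'D_(delta_mx ord0 ord0) w (rV_cons (s, y)) =
  'D_1 (fun s : R => w (rV_cons (s : measurableTypeR R, y))) s.
Proof.
rewrite /derive; apply: (congr1 (fun g => lim (g h @[h --> 0^']))).
apply/funext => h /=; congr (_ *: (w _ - _)).
apply/rowP => j; rewrite mxE [X in X + _]mxE [X in _ * X + _]mxE.
case: (unliftP ord0 j) => [k|] ->.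
  by rewrite !rV_consS /= mulr0 add0r.
by rewrite !rV_cons0.
Qed.
End slices.

(** * Averages over intervals *)

Section mean_interval.
Context {R : realType}.
Local Notation lambda := (@lebesgue_measure R).

Lemma lebesgue_measure_itv_center (c r : R) : 0 <= r ->
  lambda `[c - r, c + r]%classic = (2 * r)%:E.
Proof.
move=> r0; rewrite lebesgue_measure_itv/= lte_fin -EFinB.
case: ltP => h; congr EFin; lra.
Qed.

(** By [lipschitz_sub_le_integral], [W x] is at most [W y] plus the last integral, for any [x] and
    [y] in the two small intervals; average over both variables. *)
Lemma interval_mean_le (W : R -> R) (L c r c' r' p q : R) :
  (forall x y, `|W x - W y| <= L * `|x - y|) -> (forall x, 0 <= W x) ->
  0 < r -> 0 < r' -> `[c - r, c + r] `<=` `[p, q] -> `[c' - r', c' + r'] `<=` `[p, q] ->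
  (((2 * r')^-1)%:E * \int[lambda]_(x in `[(c' - r')%R, (c' + r')%R]) (W x)%:E <=
   ((2 * r)^-1)%:E * \int[lambda]_(x in `[(c - r)%R, (c + r)%R]) (W x)%:E +
   \int[lambda]_(x in `[p, q]) (`|'D_1 W x|)%:E)%E.
Proof.
move=> WL W0 r0 r'0 cpq c'pq.
have mI (I : interval R) : measurable ([set` I] : set (measurableTypeR R)).
  exact: measurable_itv.
have cW : continuous W by exact: (lipschitz_continuous (V := R^o)) WL.
have mW I : measurable_fun (I : set (measurableTypeR R)) (EFin \o W).
  apply/measurable_EFinP; apply: measurable_funTS; exact: continuous_measurable_fun.
have K0 : (0 <= \int[lambda]_(x in `[p, q]) (`|'D_1 W x|)%:E)%E.
  by apply: integral_ge0 => x _; rewrite lee_fin.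
apply: (mean_le_cst (mI _)) => //.
- by apply: lebesgue_measure_itv_center; exact: ltW.
- by rewrite mulr_gt0.
- by move=> x _; rewrite lee_fin.
move=> x xI.
set K := (X in (_ <= _ + X)%E).
have vr : lambda `[c - r, c + r]%classic = (2 * r)%:E.
  by apply: lebesgue_measure_itv_center; exact: ltW.
have v0 : 0 < 2 * r by rewrite mulr_gt0.
(* Writing [K] as its own average merges the right-hand side into a single average over [y]. *)
rewrite -[X in (_ <= _ + X)%E](mean_cst (mI `[c - r, c + r]) vr v0 K).
rewrite -(meanD lambda _ (mI _))//; last by move=> y _; rewrite lee_fin.
apply: (cst_le_mean (mI _) vr) => //.
- by apply: emeasurable_funD => //; exact: measurable_cst.
- by rewrite lee_fin.
- move=> y yI; apply: lipschitz_sub_le_integral WL _ _ _ (c'pq _ xI) (cpq _ yI).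
  exact: measurable_derive_R.
Qed.
End mean_interval.

(** * Averages over cubes *)

Section cube_mean.
Context {R : realType}.
Local Notation lambda := (@lebesgue_measure R).

Lemma sub_itv_center (c c' r r' : R) : `|c - c'| <= r' - r ->
  `[c - r, c + r]%classic `<=` `[c' - r', c' + r']%classic.
Proof.
move=> cc x /=; rewrite !in_itv/= -!ler_distl => xc.
rewrite (le_trans (ler_distD c _ _))//; lra.
Qed.

(** One passes from [c'] to [c] in the first coordinate by [interval_mean_le] and
    in the others, slice by slice, by induction.  As [w] is nonnegative, Tonelli
    suffices and integrability is never needed. *)
Lemma cube_mean_le n (w : 'rV[R]_n -> R) (L : R) (c c' c0 : 'rV[R]_n) (r r' r0 sigma : R) :
  0 <= L -> (forall x y, `|w x - w y| <= L * `|x - y|) -> (forall x, 0 <= w x) ->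
  0 < sigma -> sigma <= 2 * r -> sigma <= 2 * r' ->
  (forall i, `|c ord0 i - c0 ord0 i| <= r0 - r) ->
  (forall i, `|c' ord0 i - c0 ord0 i| <= r0 - r') ->
  ((((2 * r') ^+ n)^-1)%:E * \int[mu n]_(x in cube c' r') (w x)%:E <=
   (((2 * r) ^+ n)^-1)%:E * \int[mu n]_(x in cube c r) (w x)%:E +
   (sigma / sigma ^+ n)%:E *
     \int[mu n]_(x in cube c0 r0) (\sum_(i < n) `|'D_(delta_mx ord0 i) w x|)%:E)%E.
Proof.
move=> L0 wL w0 s0 sr sr'.
elim: n w c c' c0 wL w0 => [|n IH] w c c' c0 wL w0 cc0 c'c0.
  have E0 (a b : 'rV[R]_0) t t' : cube a t = cube b t' by apply/seteqP; split => x _ [].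
  rewrite (E0 _ c _ r) !expr0; apply: leeDl.
  apply: mule_ge0; first by rewrite lee_fin divr_ge0// ltW.
  by apply: integral_ge0 => x _; rewrite lee_fin; exact: sumr_ge0.
have rp : 0 < 2 * r by lra.
have r'p : 0 < 2 * r' by lra.
have cw : continuous w by exact: (lipschitz_continuous (V := 'rV[R]_n.+1) wL).
have mw : measurable_fun setT (fun x => (w x)%:E).
  by apply/measurable_EFinP; exact: continuous_measurable_rV.
have mD i : measurable_fun setT (fun x => `|'D_(delta_mx ord0 i) w x|).
  by apply: measurableT_comp => //; apply: measurable_derive_rV.
have mg0 : measurable_fun setT (fun x => (`|'D_(delta_mx ord0 ord0) w x|)%:E).
  exact/measurable_EFinP.
have mg1 : measurable_fun setT
    (fun x => (\sum_(i < n) `|'D_(delta_mx ord0 (lift ord0 i)) w x|)%:E).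
  by apply/measurable_EFinP; apply: measurable_sum.
have w0' x : (0 <= (w x)%:E)%E by rewrite lee_fin.
have g00 x : (0 <= (`|'D_(delta_mx ord0 ord0) w x|)%:E)%E by rewrite lee_fin.
have g10 x : (0 <= (\sum_(i < n) `|'D_(delta_mx ord0 (lift ord0 i)) w x|)%:E)%E.
  by rewrite lee_fin sumr_ge0.
have mI (a b : R) : measurable (`[a, b]%classic : set (measurableTypeR R)).
  exact: measurable_itv.
set J := `[c' ord0 ord0 - r', c' ord0 ord0 + r']%classic.
set I := `[c ord0 ord0 - r, c ord0 ord0 + r]%classic.
set H := `[c0 ord0 ord0 - r0, c0 ord0 ord0 + r0]%classic.
set B := cube (rV_tail c) r; set B' := cube (rV_tail c') r'.
set B0 := cube (rV_tail c0) r0.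
have mJ : measurable (J : set (measurableTypeR R)) by exact: mI.
have mI0 : measurable (I : set (measurableTypeR R)) by exact: mI.
have mH : measurable (H : set (measurableTypeR R)) by exact: mI.
have mB : measurable B by exact: measurable_cube.
have mB' : measurable B' by exact: measurable_cube.
have mB0 : measurable B0 by exact: measurable_cube.
have JH : J `<=` H by exact: sub_itv_center.
have IH' : I `<=` H by exact: sub_itv_center.
have BB0 : B `<=` B0 by apply: sub_cube => i; rewrite !mxE.
have step1 s :
  ((((2 * r') ^+ n)^-1)%:E * \int[mu n]_(y in B') (w (rV_cons (s, y)))%:E <=
   (((2 * r) ^+ n)^-1)%:E * \int[mu n]_(y in B) (w (rV_cons (s, y)))%:E +
   (sigma / sigma ^+ n)%:E * \int[mu n]_(y in B0)
     (\sum_(i < n) `|'D_(delta_mx ord0 (lift ord0 i)) w (rV_cons (s, y))|)%:E)%E.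
  under [X in (_ + _ * X)%E]eq_integral do
    under eq_bigr do rewrite derive_slice_tail.
  apply: (IH (fun y => w (rV_cons (s, y)))) => //.
  - exact: lipschitz_slice_tail.
  - by move=> i; rewrite !mxE.
  - by move=> i; rewrite !mxE.
have step2 y :
  (((2 * r')^-1)%:E * \int[lambda]_(s in J) (w (rV_cons (s, y)))%:E <=
   ((2 * r)^-1)%:E * \int[lambda]_(s in I) (w (rV_cons (s, y)))%:E +
   \int[lambda]_(s in H) (`|'D_(delta_mx ord0 ord0) w (rV_cons (s, y))|)%:E)%E.
  under [X in (_ + X)%E]eq_integral do rewrite derive_slice_head.
  apply: (@interval_mean_le _ (fun s : R => w (rV_cons (s : measurableTypeR R, y))) L) => //.
  - exact: lipschitz_slice_head.
  - lra.
  - lra.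
pose rect (X : set (measurableTypeR R)) (Y : set 'rV[R]_n) := @rV_uncons R n @^-1` (X `*` Y).
have inner0 (G : 'rV[R]_n.+1 -> \bar R) (Y : set 'rV[R]_n) s : (forall x, (0 <= G x)%E) ->
    (0 <= \int[mu n]_(y in Y) G (rV_cons (s, y)))%E.
  by move=> G0; apply: integral_ge0.
have pull1 (G : 'rV[R]_n.+1 -> \bar R) X Y k : measurable X -> measurable Y ->
    measurable_fun setT G -> (forall x, (0 <= G x)%E) -> 0 <= k ->
    (\int[lambda]_(s in X) (k%:E * \int[mu n]_(y in Y) G (rV_cons (s, y))) =
     k%:E * \int[mu n.+1]_(x in rect X Y) G x)%E.
  move=> mX mY mG G0 k0; rewrite integral_rV_cons// ge0_integralZl_EFin//.
    by move=> s _; exact: integral_ge0.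
  exact: measurable_inner_integral_rV.
have pull2 (G : 'rV[R]_n.+1 -> \bar R) X Y k : measurable X -> measurable Y ->
    measurable_fun setT G -> (forall x, (0 <= G x)%E) -> 0 <= k ->
    (\int[mu n]_(y in Y) (k%:E * \int[lambda]_(s in X) G (rV_cons (s, y))) =
     k%:E * \int[mu n.+1]_(x in rect X Y) G x)%E.
  move=> mX mY mG G0 k0; rewrite integral_rV_cons_swap// ge0_integralZl_EFin//.
    by move=> y _; exact: integral_ge0.
  exact: measurable_inner_integral_rV_swap.
have mZ d (T : measurableType d) (D : set T) (g : T -> \bar R) (k : R) :
    measurable_fun D g -> measurable_fun D (fun x => k%:E * g x)%E.
  by move=> mg; apply: emeasurable_funM => //; exact: measurable_cst.
have inner_meas X Y (G : 'rV[R]_n.+1 -> \bar R) k : measurable X -> measurable Y ->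
    measurable_fun setT G -> (forall x, (0 <= G x)%E) ->
    measurable_fun X (fun s => k%:E * \int[mu n]_(y in Y) G (rV_cons (s, y)))%E.
  by move=> mX mY mG G0; apply: mZ; exact: measurable_inner_integral_rV.
have inner_meas2 X Y (G : 'rV[R]_n.+1 -> \bar R) k : measurable X -> measurable Y ->
    measurable_fun setT G -> (forall x, (0 <= G x)%E) ->
    measurable_fun Y (fun y => k%:E * \int[lambda]_(s in X) G (rV_cons (s, y)))%E.
  by move=> mX mY mG G0; apply: mZ; exact: measurable_inner_integral_rV_swap.
have mr : measurable (rect H B0) by rewrite /rect -cubeS; exact: measurable_cube.
rewrite !cubeS -/J -/I -/H -/B -/B' -/B0.
have -> : ((((2 * r') ^+ n.+1)^-1)%:E * \int[mu n.+1]_(x in rect J B') (w x)%:E =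
    ((2 * r')^-1)%:E * \int[lambda]_(s in J)
      ((((2 * r') ^+ n)^-1)%:E * \int[mu n]_(y in B') (w (rV_cons (s, y)))%:E))%E.
  rewrite (pull1 (fun x => (w x)%:E))// ?invr_ge0 ?exprn_ge0 ?ltW//.
  by rewrite muleA -EFinM exprS invfM.
pose W x := (w x)%:E; rewrite -/(W _).
pose g1 x := (\sum_(i < n) `|'D_(delta_mx ord0 (lift ord0 i)) w x|)%:E.
pose g0 x := (`|'D_(delta_mx ord0 ord0) w x|)%:E.
pose a' (s : measurableTypeR R) :=
  ((((2 * r') ^+ n)^-1)%:E * \int[mu n]_(y in B') W (rV_cons (s, y)))%E.
pose a (s : measurableTypeR R) :=
  ((((2 * r) ^+ n)^-1)%:E * \int[mu n]_(y in B) W (rV_cons (s, y)))%E.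
pose b (s : measurableTypeR R) :=
  ((sigma / sigma ^+ n)%:E * \int[mu n]_(y in B0) g1 (rV_cons (s, y)))%E.
have ma' : measurable_fun J a' by exact: (inner_meas _ _ W _ (mI _ _) mB' mw w0').
have ma : measurable_fun J a by exact: (inner_meas _ _ W _ (mI _ _) mB mw w0').
have mb X : measurable X -> measurable_fun X b.
  by move=> mX; exact: (inner_meas _ _ g1 _ mX mB0 mg1 g10).
have k0 k t : 0 <= t -> 0 <= (t ^+ k)^-1 :> R by move=> t0; rewrite invr_ge0 exprn_ge0.
have rn0 k : 0 <= ((2 * r) ^+ k)^-1 by exact/k0/ltW.
have r'n0 k : 0 <= ((2 * r') ^+ k)^-1 by exact/k0/ltW.
have sn0 : 0 <= sigma / sigma ^+ n by rewrite mulr_ge0 ?k0// ltW.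
have a'0 s : (0 <= a' s)%E by apply: mule_ge0; [rewrite lee_fin|exact: (inner0 W)].
have a0 s : (0 <= a s)%E by apply: mule_ge0; [rewrite lee_fin|exact: (inner0 W)].
have b0 s : (0 <= b s)%E by apply: mule_ge0; [rewrite lee_fin|exact: (inner0 g1)].
have mbJ := mb _ mJ.
(* The induction hypothesis [step1] is averaged over the first coordinate; [T2] and [T1] bound the
   two resulting terms. *)
have T0 : (((2 * r')^-1)%:E * \int[lambda]_(s in J) a' s <=
    ((2 * r')^-1)%:E * \int[lambda]_(s in J) a s +
    ((2 * r')^-1)%:E * \int[lambda]_(s in J) b s)%E.
  rewrite -(meanD lambda _ mJ)//.
  apply: (le_mean lambda mJ r'p) => //.
  - by apply: emeasurable_funD.
  - by move=> s _; exact: step1.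
apply: (le_trans T0).
(* As [sigma <= 2 * r'], averaging over [J] costs at most the factor [sigma^-1], which cancels the
   numerator [sigma] in [b]. *)
have T2 : (((2 * r')^-1)%:E * \int[lambda]_(s in J) b s <=
    ((sigma ^+ n)^-1)%:E * \int[mu n.+1]_(x in rect H B0) g1 x)%E.
  apply: (@le_trans _ _ ((sigma^-1)%:E * \int[lambda]_(s in H) b s)%E).
    apply: lee_pmul.
    - by rewrite lee_fin invr_ge0 ltW.
    - by apply: integral_ge0.
    - by rewrite lee_fin lef_pV2.
    - by apply: ge0_subset_integral => //; exact: mb.
  by rewrite (pull1 g1)// muleA -EFinM mulrA mulVf ?gt_eqF// mul1r.
(* Tonelli makes the first coordinate the inner variable, so [step2] applies for each [y]; averaging
   over [B] costs at most [(sigma ^+ n)^-1]. *)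
have T1 : (((2 * r')^-1)%:E * \int[lambda]_(s in J) a s <=
    (((2 * r) ^+ n.+1)^-1)%:E * \int[mu n.+1]_(x in rect I B) W x +
    ((sigma ^+ n)^-1)%:E * \int[mu n.+1]_(x in rect H B0) g0 x)%E.
  rewrite (pull1 W)// muleCA -(pull2 W)//; last by rewrite invr_ge0 ltW.
  pose e (y : 'rV[R]_n) := (((2 * r)^-1)%:E * \int[lambda]_(s in I) W (rV_cons (s, y)))%E.
  pose h (y : 'rV[R]_n) := (\int[lambda]_(s in H) g0 (rV_cons (s, y)))%E.
  have e0 y : (0 <= e y)%E.
    apply: mule_ge0; first by rewrite lee_fin invr_ge0 ltW.
    by apply: integral_ge0 => s _; exact: w0'.
  have h0 y : (0 <= h y)%E by apply: integral_ge0 => s _; exact: g00.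
  have me : measurable_fun B e by exact: (inner_meas2 _ _ W _ (mI _ _) mB mw w0').
  have mh Y : measurable Y -> measurable_fun Y h.
    by move=> mY; exact: (measurable_inner_integral_rV_swap (mI _ _) mY mg0 g00).
  apply: (@le_trans _ _ ((((2 * r) ^+ n)^-1)%:E * \int[mu n]_(y in B) (e y + h y))%E).
    apply: (le_mean (mu n) mB) => //.
    - by rewrite exprn_gt0.
    - exact: (inner_meas2 _ _ W _ (mI _ _) mB mw w0').
    - by apply: emeasurable_funD => //; exact: mh.
    - move=> y _; apply: mule_ge0; first by rewrite lee_fin invr_ge0 ltW.
      by apply: integral_ge0 => s _; exact: w0'.
    - by move=> y _; exact: step2.
  rewrite meanD//; last exact: mh.
  apply: leeD.
    rewrite (pull2 W)//; last by rewrite invr_ge0 ltW.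
    by rewrite muleA -EFinM -invfM -exprSr.
  rewrite (integral_rV_cons_swap (G := g0))//.
  apply: lee_pmul.
  - by rewrite lee_fin.
  - by apply: integral_ge0.
  - rewrite lee_fin lef_pV2 ?posrE ?exprn_gt0//.
    by rewrite lerXn2r ?nnegrE// ltW.
  - by apply: ge0_subset_integral => //; exact: mh.
apply: (le_trans (leeD T1 T2)); rewrite -addeA leeD2l//.
(* Both error terms carry the factor [sigma / sigma ^+ n.+1], and [g0 + g1] is the sum over all
   coordinates. *)
rewrite exprS invfM mulrA divff ?gt_eqF// mul1r -ge0_muleDr.
- have mg0r : measurable_fun (rect H B0) g0 by apply: measurable_funS mg0.
  have mg1r : measurable_fun (rect H B0) g1 by apply: measurable_funS mg1.
  rewrite -ge0_integralD//.
  rewrite le_eqVlt; apply/orP; left; apply/eqP; congr (_ * _)%E.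
  by apply: eq_integral => x _; rewrite /g0 /g1 -EFinD big_ord_recl.
- by move=> x _; exact: g00.
- by move=> x _; exact: g10.
- by apply: integral_ge0 => x _; exact: g00.
- by apply: integral_ge0 => x _; exact: g10.
Qed.
End cube_mean.

(** * The truncated logarithm *)

Section directional.
Context {R : realType} {V : normedModType R}.
Implicit Types (f w : V -> R) (x v : V).

Lemma derive_line f x v : 'D_v f x = 'D_1 (fun h : R => f (h *: v + x)) 0.
Proof.
rewrite /derive; apply: (congr1 (fun g => lim (g h @[h --> 0^']))).
by apply/funext => h /=; rewrite addr0 scale0r add0r [_%:A]mulr1.
Qed.

(** Along the line [h *: v + x] this is the chain rule in one variable. *)
Lemma is_derive_comp_real f (g : R -> R) x v a :
  derivable f x v -> is_derive (f x) 1 g a -> is_derive x v (g \o f) (a * 'D_v f x).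
Proof.
move=> df dg.
have D : is_derive (0:R) (1:R) (g \o (fun h : R => f (h *: v + x))) (a * 'D_v f x).
  apply: is_derive1_comp; first by rewrite scale0r add0r.
  by rewrite derive_line; split => //; exact: (derivable1P f x v).1.
split; first by apply/derivable1P; case: D.
by rewrite derive_line; case: D.
Qed.

(** The limit of a divergent filter is [point], which is [0] in [R]. *)
Lemma not_derivable_derive f x v : ~ derivable f x v -> 'D_v f x = 0.
Proof. by move=> ndf; apply: xgetPN => l fl; apply: ndf; apply/cvg_ex; exists l. Qed.

Lemma derive_at_min f x v : (forall y, f x <= f y) -> 'D_v f x = 0.
Proof.
move=> fmin; have [df|] := pselect (derivable f x v); last exact: not_derivable_derive.
set d := 'D_v f x; apply/eqP; apply: contrapT => /negP d0.
have /cvgrPdist_lt : h^-1 *: (f (h *: v + x) - f x) @[h --> 0^'] --> d.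
  exact: df.
move=> /(_ `|d|); rewrite normr_gt0 => /(_ d0) /nbhs_ballP[e /= e0 eB].
(* A step against the sign of [d] would bring [f] below its minimum. *)
pose h : R := - Num.sg d * (e / 2).
have hd : h * d < 0.
  by rewrite /h mulrAC pmulr_llt0 ?divr_gt0// mulNr -normrEsg oppr_lt0 normr_gt0.
have h0 : h != 0 by apply: contraTneq hd => ->; rewrite mul0r ltxx.
have /eB/(_ h0) : ball 0 e h.
  rewrite /ball/= sub0r normrN normrM normrN normr_sg d0 mul1r gtr0_norm ?divr_gt0//.
  by rewrite ltr_pdivrMr// ltr_pMr// ltr1n.
set q := h^-1 *: _ => dq.
(* Being closer to [d] than [|d|], the quotient [q] has the sign of [d]: expand the squares. *)
have qd : 0 < q * d.
  have : `|d - q| ^+ 2 < `|d| ^+ 2 by rewrite ltr_pXn2r// ?nnegrE.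
  rewrite !real_normK ?num_real// sqrrB; have := sqr_ge0 q; rewrite mulr2n (mulrC q); lra.
have hq : 0 <= h * q by rewrite /q /GRing.scale/= mulrA divff// mul1r subr_ge0.
have : (h * d) * (q * d) < 0 by rewrite nmulr_rlt0.
by rewrite mulrACA ltNge mulr_ge0// -expr2 sqr_ge0.
Qed.

End directional.

Section truncated_log.
Context {R : realType}.

(** [ln |t|] truncated below at [ln tau], and shifted so as to be nonnegative. *)
Definition tlog (tau t : R) := ln (Num.max `|t| tau / tau).

Lemma tlog_arg_ge1 (tau t : R) : 0 < tau -> 1 <= Num.max `|t| tau / tau.
Proof. by move=> tau0; rewrite ler_pdivlMr// mul1r le_max lexx orbT. Qed.

Lemma tlog_ge0 (tau t : R) : 0 < tau -> 0 <= tlog tau t.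
Proof. by move=> tau0; rewrite ln_ge0// tlog_arg_ge1. Qed.

Lemma tlog_eq0 (tau t : R) : 0 < tau -> `|t| <= tau -> tlog tau t = 0.
Proof. by move=> tau0 tt; rewrite /tlog max_r// divff ?gt_eqF// ln1. Qed.

Lemma tlogE (tau t : R) : 0 < tau -> tau <= `|t| -> tlog tau t = ln (`|t| / tau).
Proof. by move=> tau0 tt; rewrite /tlog max_l. Qed.

(** For [v <= u], the difference is [ln (1 + (u - v) / v)], at most [(u - v) / v]. *)
Lemma ln_lipschitz_ge1 (u v : R) : 1 <= u -> 1 <= v -> `|ln u - ln v| <= `|u - v|.
Proof.
wlog uv : u v / v <= u.
  move=> H u1 v1; have [vu|/ltW uv] := leP v u; first exact: H.
  by rewrite distrC (distrC u); apply: H.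
move=> u1 v1; have v0 : 0 < v by lra.
have u0 : 0 < u by lra.
rewrite ger0_norm ?subr_ge0 ?ler_ln// ger0_norm ?subr_ge0// -ln_div//.
have -> : u / v = 1 + (u - v) / v by field; lra.
apply: (le_trans (le_ln1Dx _)).
  by rewrite (@lt_le_trans _ _ 0)// divr_ge0 ?subr_ge0// ltW.
by rewrite ler_pdivrMr// ler_peMr// subr_ge0.
Qed.

Lemma tlog_lipschitz (tau s t : R) : 0 < tau -> `|tlog tau s - tlog tau t| <= tau^-1 * `|s - t|.
Proof.
move=> tau0; apply: (le_trans (ln_lipschitz_ge1 (tlog_arg_ge1 _ tau0) (tlog_arg_ge1 _ tau0))).
rewrite -mulrBl normrM mulrC (gtr0_norm (x := tau^-1)) ?invr_gt0//.
rewrite ler_wpM2l ?invr_ge0 ?(ltW tau0)//.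
have := ler_dist_dist s t; rewrite !ler_norml => /andP[? ?].
by rewrite /Num.max; case: ltP => ?; case: ltP => ?; lra.
Qed.

Context {V : normedModType R}.
Implicit Types (F : V -> R) (x v : V).

Lemma near_sg F x : {for x, continuous F} -> F x != 0 ->
  \forall y \near x, Num.sg (F y) = Num.sg (F x).
Proof.
move=> cF; rewrite neq_lt => /orP[Fx|Fx].
  by near=> y; rewrite (ltr0_sg Fx) ltr0_sg//; near: y; apply: cvgr_lt Fx; exact: cF.
by near=> y; rewrite (gtr0_sg Fx) gtr0_sg//; near: y; apply: cvgr_gt Fx; exact: cF.
Unshelve. all: by end_near. Qed.

(** Where [|F x|] exceeds [tau], [F] is locally a constant times [expR (tlog tau (F y))].
    Differentiating this identity asks for derivability of the truncated logarithm only, and without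
    it the left side is 0. *)
Lemma derive_tlog_le F x v (tau : R) : 0 < tau -> {for x, continuous F} ->
  `|'D_v (tlog tau \o F) x| <= `|'D_v F x / F x|.
Proof.
move=> tau0 cF; have [Fx|Fx] := leP `|F x| tau.
  (* [tlog tau \o F] attains its minimum at [x]. *)
  by rewrite derive_at_min ?normr0// => y /=; rewrite (tlog_eq0 _ Fx)// tlog_ge0.
have [dw|/not_derivable_derive ->] := pselect (derivable (tlog tau \o F) x v); last first.
  by rewrite normr0.
have Fx0 : F x != 0 by rewrite -normr_gt0 (lt_trans tau0).
have FE : \forall y \near x, Num.sg (F x) * tau * expR (tlog tau (F y)) = F y.
  near=> y.
  have Fy : tau < `|F y|.
    by near: y; apply: cvgr_gt Fx; apply: cvg_norm; exact: cF.
  rewrite tlogE// ?ltW// lnK ?posrE ?divr_gt0// ?(lt_trans tau0)//.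
  rewrite -mulrA [tau * _]mulrC divfK ?gt_eqF// -(near (near_sg cF Fx0) y)//.
  by rewrite -numEsg.
have Dexp := is_derive_comp_real dw (is_derive_expR _).
have := near_eq_is_derive FE (is_deriveZ (Num.sg (F x) * tau) Dexp).
move=> /(@derive_val _ _ _ _ _ _ _) ->.
rewrite /GRing.scale/= mulrA (nbhs_singleton FE) mulrAC divff// mul1r.
exact: lexx.
Unshelve. all: by end_near. Qed.

(** If [F] is not derivable the left side is 0; otherwise [F] keeps its sign near [x] and the chain
    rule applies. This reduces the second integral of the theorem to the same estimate as the
    first. *)
Lemma derive_ln_norm_ge F x v : {for x, continuous F} -> F x != 0 ->
  `|'D_v F x / F x| <= `|'D_v (fun y => ln `|F y|) x|.
Proof.
move=> cF Fx0.
have [dF|/not_derivable_derive ->] := pselect (derivable F x v); last first.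
  by rewrite mul0r normr0.
have FE : \forall y \near x, ln (Num.sg (F x) * F y) = ln `|F y|.
  near=> y; rewrite -(near (near_sg cF Fx0) y)//.
  by rewrite normrEsg.
have sF : 0 < Num.sg (F x) * F x by rewrite -normrEsg normr_gt0.
have dsF : derivable (Num.sg (F x) \*: F) x v by exact: derivableZ.
have := near_eq_is_derive FE (is_derive_comp_real dsF (is_derive1_ln sF)).
move=> /(@derive_val _ _ _ _ _ _ _) ->.
rewrite deriveZ//= /GRing.scale/= invfM mulrACA mulVf ?sgr_eq0// mul1r mulrC.
exact: lexx.
Unshelve. all: by end_near. Qed.

End truncated_log.

(** * Divergence for globally Lipschitz functions *)

(** Either [t <= kappa], or [t / kappa] exceeds 1 and is at most its [n]-th power. *)
Lemma le_power_young (R : realFieldType) n (t kappa : R) :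
  (0 < n)%N -> 0 <= t -> 0 < kappa ->
  t <= kappa + kappa / kappa ^+ n * t ^+ n.
Proof.
move=> n0 t0 k0; have kn : 0 < kappa ^+ n by rewrite exprn_gt0.
have [tk|kt] := leP t kappa.
  by rewrite ler_wpDr// mulr_ge0 ?exprn_ge0// divr_ge0 ?(ltW k0) ?(ltW kn).
rewrite ler_wpDl ?(ltW k0)// -mulrA [_^-1 * _]mulrC -expr_div_n.
rewrite -ler_pdivrMl// mulrC -[leLHS]expr1.
by rewrite ler_eXn2l// ltr_pdivlMr// mul1r.
Qed.

Section core.
Context {R : realType} (n : nat) (F : 'rV[R]_n -> R) (L : R).
Hypotheses (n0 : (0 < n)%N) (L0 : 0 < L).
Hypothesis FL : forall x y, `|F x - F y| <= L * `|x - y|.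

Let g i x := `|'D_(delta_mx ord0 i) F x / F x|.
(** Up to the factor [n%:R], a lower bound for the [n]-th power of the Euclidean norm. It vanishes
    at the zeros of [F], the inverse of 0 being 0. *)
Let G x := \sum_(i < n) g i x ^+ n.

Let cF : continuous F. Proof. exact: (lipschitz_continuous (V := 'rV[R]_n)) FL. Qed.

Let G0 x : 0 <= G x.
Proof. by apply: sumr_ge0 => i _; apply: exprn_ge0; exact: normr_ge0. Qed.

Let mg i : measurable_fun setT (g i).
Proof.
rewrite (_ : g i = fun x => `|'D_(delta_mx ord0 i) F x| * (`|F x| `^ (-1))).
  apply: measurable_funM.
    by apply: measurableT_comp => //; exact: measurable_derive_rV.
  apply: (measurableT_comp (measurable_powR (-1))).
  by apply: measurableT_comp => //; exact: continuous_measurable_rV.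
by apply/funext => x; rewrite powR_inv1// -normfV -normrM.
Qed.

Lemma measurable_log_gradient_power : measurable_fun setT G.
Proof. by apply: measurable_sum => i; apply: measurable_funX. Qed.

Let mG := measurable_log_gradient_power.

Lemma tlog_cube_mean_le (c c' c0 : 'rV[R]_n) (r r' r0 sigma tau eta : R) :
  0 < tau -> 0 < eta -> 0 < sigma -> 0 <= r0 -> sigma <= 2 * r -> sigma <= 2 * r' ->
  (forall i, `|c ord0 i - c0 ord0 i| <= r0 - r) ->
  (forall i, `|c' ord0 i - c0 ord0 i| <= r0 - r') ->
  ((((2 * r') ^+ n)^-1)%:E * \int[mu n]_(x in cube c' r') (tlog tau (F x))%:E <=
   (((2 * r) ^+ n)^-1)%:E * \int[mu n]_(x in cube c r) (tlog tau (F x))%:E +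
   (n%:R * eta * (2 * r0 / sigma) ^+ n)%:E +
   (eta / eta ^+ n)%:E * \int[mu n]_(x in cube c0 r0) (G x)%:E)%E.
Proof.
move=> tau0 eta0 s0 r00 sr sr' cc0 c'c0.
have tL x y : `|tlog tau (F x) - tlog tau (F y)| <= tau^-1 * L * `|x - y|.
  apply: (le_trans (tlog_lipschitz _ _ tau0)).
  by rewrite -mulrA ler_wpM2l// invr_ge0 ltW.
have tL0 : 0 <= tau^-1 * L by rewrite mulr_ge0 ?invr_ge0// ltW.
have := cube_mean_le tL0 tL (fun x => tlog_ge0 (F x) tau0) s0 sr sr' cc0 c'c0.
move=> /le_trans; apply; rewrite -addeA leeD2l//.
(* With this [kappa] the powers of [sigma] cancel in front of the integral of [G], whose coefficient
   [eta / eta ^+ n] no longer depends on the size of the cubes. This is the scale invariance of the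
   exponent [n]. *)
pose kappa := eta / sigma; have kappa0 : 0 < kappa by rewrite divr_gt0.
have mcube := measurable_cube c0 r0.
have mGc : measurable_fun (cube c0 r0) (EFin \o G).
  by apply/measurable_EFinP; exact: measurable_funTS.
have k0 : 0 <= kappa / kappa ^+ n.
  by rewrite divr_ge0 ?exprn_ge0 ?ltW.
have ctL : continuous (fun x => tlog tau (F x)).
  exact: (lipschitz_continuous (V := 'rV[R]_n)) tL.
apply: (@le_trans _ _ ((sigma / sigma ^+ n)%:E * \int[mu n]_(x in cube c0 r0)
  ((n%:R * kappa)%:E + (kappa / kappa ^+ n)%:E * (G x)%:E))%E).
  apply: lee_wpmul2l; first by rewrite lee_fin divr_ge0 ?exprn_ge0 ?ltW.
  apply: ge0_le_integral => //.
  - by move=> x _; rewrite lee_fin sumr_ge0.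
  - apply/measurable_EFinP; apply: measurable_sum => i.
    apply: measurableT_comp => //; apply: measurable_funTS.
    exact: measurable_derive_rV.
  - apply: emeasurable_funD; first exact: measurable_cst.
    by apply: emeasurable_funM => //; exact: measurable_cst.
  - move=> x _; rewrite -EFinM -EFinD lee_fin /G mulr_sumr.
    rewrite mulr_natl -[n in kappa *+ n]card_ord -sumr_const -big_split/=.
    apply: ler_sum => i _; apply: le_trans (le_power_young n0 _ kappa0); last exact: normr_ge0.
    apply: derive_tlog_le => //; exact: cF.
have nk0 : (0 <= (n%:R * kappa)%:E)%E by rewrite lee_fin mulr_ge0// ltW.
have kG0 x : (0 <= (kappa / kappa ^+ n)%:E * (G x)%:E)%E by rewrite -EFinM lee_fin mulr_ge0.
have mkG : measurable_fun (cube c0 r0) (fun x => (kappa / kappa ^+ n)%:E * (G x)%:E)%E.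
  by apply: emeasurable_funM => //; exact: measurable_cst.
rewrite ge0_integralD//.
rewrite [X in (_ * (X + _))%E](integral_cst (mu n) mcube).
rewrite [X in (_ * (_ * X + _))%E](lebesgue_measure_cube _ r00).
rewrite ge0_integralZl_EFin//; last by move=> x _; rewrite lee_fin.
rewrite ge0_muleDr; last 2 first.
- by apply: mule_ge0; [exact: nk0|rewrite lee_fin exprn_ge0// mulr_ge0].
- by apply: mule_ge0; [rewrite lee_fin|apply: integral_ge0 => x _; rewrite lee_fin].
rewrite muleA -!EFinM; apply: leeD.
  rewrite lee_fin /kappa expr_div_n le_eqVlt; apply/orP; left; apply/eqP.
  by field; rewrite expf_neq0 ?gt_eqF.
rewrite muleA -EFinM.
rewrite (_ : sigma / sigma ^+ n * (kappa / kappa ^+ n) = eta / eta ^+ n)//.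
rewrite /kappa expr_div_n; field.
by rewrite !expf_neq0 ?gt_eqF.
Qed.

Let rad (rho : R) k := rho / 2 ^+ k.

(** Absolute continuity of the integral, as the measure of the cubes tends to 0. *)
Lemma cube_energy_small (z : 'rV[R]_n) (rho e : R) : 0 < rho -> 0 < e ->
  (\int[mu n]_(x in cube z rho) (G x)%:E < +oo)%E ->
  exists k0, forall k, (k0 <= k)%N ->
    (\int[mu n]_(x in cube z (rad rho k)) (G x)%:E <= e%:E)%E.
Proof.
move=> rho0 e0 Aoo; set C := cube z rho.
have mC : measurable C by exact: measurable_cube.
have intG : (mu n).-integrable C (EFin \o G).
  apply/integrableP; split; first by apply/measurable_EFinP; exact: measurable_funTS.
  by under eq_integral => x _ do rewrite /= ger0_norm//.
have := intG; rewrite integrable_mkcond// (restrict_EFin G) => intG'.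
have [d [d0 dG]] := integral_normr_continuous intG' e0.
have rad0 j : 0 < rad rho j by rewrite divr_gt0 ?exprn_gt0.
have [k0 k0d] : exists k0, (2 * rad rho k0) ^+ n < d.
  pose k0 := (Num.truncn (2 * rho / Num.min 1 d)).+1.
  (* From [k0 < 2 ^ k0] the edge is below both 1 and [d]; being below 1, it bounds its own [n]-th
     power. *)
  have m0 : 0 < Num.min 1 d by rewrite lt_min ltr01.
  exists k0; have k0P : 2 * rad rho k0 < Num.min 1 d.
    rewrite /rad mulrA ltr_pdivrMr ?exprn_gt0// -ltr_pdivrMl// [ltLHS]mulrC.
    apply: (@lt_trans _ _ (k0%:R)); first exact: truncnS_gt.
    by rewrite -natrX ltr_nat ltn_expl.
  move: k0P; rewrite lt_min => /andP[k01 k0d]; apply: le_lt_trans k0d.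
  by rewrite -[leRHS]expr1 ler_wiXn2l ?(ltW k01)// mulr_ge0 ?(ltW (rad0 _)).
exists k0 => k k0k.
have radS i j : (i <= j)%N -> rad rho j <= rad rho i.
  move=> ij; rewrite ler_pM2l// lef_pV2 ?posrE ?exprn_gt0//.
  by rewrite ler_weXn2l// ler1n.
have sub i j : (i <= j)%N -> cube z (rad rho j) `<=` cube z (rad rho i).
  by move=> /radS ij; apply: sub_cube => l; rewrite subrr normr0 subr_ge0.
have mcube j := measurable_cube z (rad rho j).
have mGj j : measurable_fun (cube z (rad rho j)) (EFin \o G).
  by apply/measurable_EFinP; exact: measurable_funTS.
apply: (@le_trans _ _ (\int[mu n]_(x in cube z (rad rho k0)) (G x)%:E)%E).
  by apply: ge0_subset_integral => //; [move=> x _; rewrite lee_fin|exact: sub].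
have C0 : cube z (rad rho 0) = C by rewrite /rad expr0 divr1.
have fin : (\int[mu n]_(x in cube z (rad rho k0)) (G x)%:E \is a fin_num)%E.
  rewrite ge0_fin_numE; last by apply: integral_ge0 => x _; rewrite lee_fin.
  apply: le_lt_trans Aoo; rewrite -/C -C0.
  by apply: ge0_subset_integral => //; [move=> x _; rewrite lee_fin|exact: sub].
have muk : (mu n (cube z (rad rho k0)) < d%:E)%E.
  by rewrite lebesgue_measure_cube ?(ltW (rad0 _))// lte_fin.
have := dG _ (mcube k0) muk; rewrite /Rintegral.
rewrite (_ : (\int[mu n]_(x in _) _)%E = (\int[mu n]_(x in cube z (rad rho k0)) (G x)%:E)%E).
  by move=> /ltW; rewrite -lee_fin fineK.
apply: eq_integral => x; rewrite inE => xk.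
rewrite patchE mem_set ?ger0_norm//.
by rewrite -C0; exact: sub xk.
Qed.

Lemma log_gradient_integral_infinite (z a : 'rV[R]_n) (rho : R) :
  0 < rho -> F z = 0 -> F a != 0 -> (forall i, `|a ord0 i - z ord0 i| < rho) ->
  (\int[mu n]_(x in cube z rho) (G x)%:E = +oo)%E.
Proof.
move=> rho0 Fz Fa az; apply/eqP; rewrite eq_le leey/= leNgt; apply/negP => Aoo.
have ln2 : 0 < ln (2 : R) by rewrite ln_gt0// ltr1n.
have rad0 j : 0 < rad rho j by rewrite divr_gt0 ?exprn_gt0.
have radE j : rad rho j = 2 * rad rho j.+1.
  by rewrite /rad exprS; field; rewrite expf_neq0.
(* For cubes of ratio 2 the constant error term is then [ln 2 / 4], and the energy term is made no
   larger. Each halving loses at most [ln 2 / 2], half of what [ln (mu0 / tau)] gains when [tau] is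
   halved. *)
pose eta : R := ln 2 / (4 * n%:R * 2 ^+ n).
have nR : 0 < n%:R :> R by rewrite ltr0n.
have eta0 : 0 < eta by rewrite divr_gt0// !mulr_gt0 ?exprn_gt0.
have een : 0 < eta / eta ^+ n by rewrite divr_gt0 ?exprn_gt0.
have e0 : 0 < ln 2 / 4 / (eta / eta ^+ n) by apply: divr_gt0 => //; exact: divr_gt0.
have [k0 k0P] := cube_energy_small rho0 e0 Aoo.
pose T tau k := ((((2 * rad rho k) ^+ n)^-1)%:E *
  \int[mu n]_(x in cube z (rad rho k)) (tlog tau (F x))%:E)%E.
have step tau k : 0 < tau -> (k0 <= k)%N -> (T tau k <= T tau k.+1 + (ln 2 / 2)%:E)%E.
  move=> tau0 k0k.
  have sub0 (s : R) : 0 <= s -> forall i : 'I_n, `|z ord0 i - z ord0 i| <= s.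
    by move=> s0 i; rewrite subrr normr0.
  have rad2 : rad rho k <= 2 * rad rho k by have := rad0 k; lra.
  have radS : rad rho k <= 2 * rad rho k.+1 by rewrite radE.
  have radk : 0 <= rad rho k - rad rho k.+1 by rewrite radE; have := rad0 k.+1; lra.
  have rad00 : 0 <= rad rho k - rad rho k by rewrite subrr.
  apply: (le_trans (tlog_cube_mean_le tau0 eta0 (rad0 k) (ltW (rad0 k)) radS rad2
    (sub0 _ radk) (sub0 _ rad00))).
  rewrite -addeA; apply: leeD => //; rewrite mulfK ?gt_eqF//.
  apply: (@le_trans _ _ ((ln 2 / 4)%:E + (ln 2 / 4)%:E)%E).
    apply: leeD.
      rewrite lee_fin /eta le_eqVlt; apply/orP; left; apply/eqP; field.
      by rewrite expf_neq0//= gt_eqF.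
    apply: (@le_trans _ _ ((eta / eta ^+ n)%:E * (ln 2 / 4 / (eta / eta ^+ n))%:E)%E).
      by apply: lee_wpmul2l; [rewrite lee_fin ltW|exact: k0P].
    by rewrite -EFinM lee_fin mulrC divfK ?gt_eqF.
  by rewrite -EFinD lee_fin; lra.
have steps tau m : 0 < tau -> (T tau k0 <= T tau (k0 + m)%N + (m%:R * (ln 2 / 2))%:E)%E.
  move=> tau0; elim: m => [|m IH]; first by rewrite addn0 mul0r adde0.
  apply: (le_trans IH); rewrite addnS -[m.+1%:R]natr1 mulrDl mul1r.
  rewrite [(_ + ln 2 / 2)%R]addrC EFinD addeA.
  by rewrite leeD2r// step// leq_addr.
pose mu0 := `|F a| / 2; have mu00 : 0 < mu0 by rewrite divr_gt0// normr_gt0.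
(* [d1] keeps the cube about [a] inside [cube z rho]; the radius [mu0 / L] lets [|F|] drop by at
   most half of [|F a|]. *)
have [delta delta0 [daz aF]] : exists2 delta : R, 0 < delta &
    (forall i, `|a ord0 i - z ord0 i| <= rho - delta) /\
    forall x, cube a delta x -> mu0 <= `|F x|.
  pose d1 := \big[Num.min/rho]_(i < n) (rho - `|a ord0 i - z ord0 i|).
  have d10 : 0 < d1 by apply: lt_bigmin => // i _; rewrite subr_gt0.
  exists (Num.min d1 (mu0 / L)); first by rewrite lt_min d10 divr_gt0.
  split=> [i|x xa].
    have : d1 <= rho - `|a ord0 i - z ord0 i| by exact: bigmin_le_cond.
    have : Num.min d1 (mu0 / L) <= d1 by rewrite ge_min lexx.
    by move=> ? ?; lra.
  have : `|a - x| <= mu0 / L.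
    apply: rV_norm_le; first by rewrite divr_ge0 ?ltW.
    move=> i; rewrite mxE [X in _ + X]mxE distrC (le_trans (xa i))//.
    by rewrite ge_min lexx orbT.
  rewrite -(ler_pM2l L0) mulrCA divff ?gt_eqF// mulr1 => axL.
  have Fax := le_trans (FL a x) axL.
  have Fa2 : `|F a| = mu0 * 2 by rewrite /mu0 divfK.
  have := lerB_dist (F a) (F x); rewrite Fa2 => Fax'; lra.
pose sigma := 2 * Num.min delta (rad rho k0).
have sigma0 : 0 < sigma by rewrite mulr_gt0// lt_min delta0 rad0.
have sd : sigma <= 2 * delta by rewrite ler_pM2l// ge_min lexx.
have sk : sigma <= 2 * rad rho k0 by rewrite ler_pM2l// ge_min lexx orbT.
have A0 : (0 <= \int[mu n]_(x in cube z rho) (G x)%:E)%E.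
  by apply: integral_ge0 => x _; rewrite lee_fin.
pose A := fine (\int[mu n]_(x in cube z rho) (G x)%:E)%E.
pose K := n%:R * eta * (2 * rho / sigma) ^+ n + eta / eta ^+ n * A.
pose M tau := ((((2 * delta) ^+ n)^-1)%:E *
  \int[mu n]_(x in cube a delta) (tlog tau (F x))%:E)%E.
(* The point is that [K] does not depend on [tau]. *)
have start tau : 0 < tau -> (M tau <= T tau k0 + K%:E)%E.
  move=> tau0.
  have radrho : 0 <= rho - rad rho k0.
    by rewrite subr_ge0 ler_pdivrMr ?exprn_gt0// ler_peMr ?(ltW rho0)// exprn_ege1// ler1n.
  have zz i : `|z ord0 i - z ord0 i| <= rho - rad rho k0 by rewrite subrr normr0.
  apply: (le_trans (tlog_cube_mean_le tau0 eta0 sigma0 (ltW rho0) sk sd zz daz)).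
  by rewrite /K EFinD [X in (_ <= _ + (_ + X))%E]EFinM /A fineK ?ge0_fin_numE// addeA.
have v0 : 0 < (2 * delta) ^+ n by rewrite exprn_gt0// mulr_gt0.
have ma : mu n (cube a delta) = ((2 * delta) ^+ n)%:E.
  by rewrite lebesgue_measure_cube ?(ltW delta0).
have lower tau : 0 < tau -> ((ln (mu0 / tau))%:E <= M tau)%E.
  move=> tau0; have [l0|l0] := leP 0 (ln (mu0 / tau)); last first.
    apply: (@le_trans _ _ 0%E); first by rewrite lee_fin ltW.
    apply: mule_ge0; first by rewrite lee_fin invr_ge0 ltW.
    by apply: integral_ge0 => x _; rewrite lee_fin tlog_ge0.
  apply: (cst_le_mean (measurable_cube a delta) ma v0).
  - apply/measurable_EFinP; apply: measurable_funTS; apply: continuous_measurable_rV.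
    apply: (lipschitz_continuous (V := 'rV[R]_n) (L := tau^-1 * L)) => x y.
    apply: (le_trans (tlog_lipschitz _ _ tau0)).
    by rewrite -mulrA ler_wpM2l// invr_ge0 ltW.
  - by rewrite lee_fin.
  - move=> x /aF xmu; rewrite lee_fin ler_ln ?posrE ?divr_gt0//.
      by rewrite ler_pM2r ?invr_gt0// le_max xmu.
    by rewrite normr_gt0.
  by rewrite lt_max tau0 orbT.
pose lnc := ln (mu0 / (L * rho)).
(* With this [tau], [tlog tau \o F] vanishes on the smallest cube. *)
have bound m : lnc + (k0 + m)%:R * ln 2 <= m%:R * (ln 2 / 2) + K.
  pose tau := L * rad rho (k0 + m).
  have tau0 : 0 < tau by rewrite mulr_gt0.
  have T0 : T tau (k0 + m)%N = 0%E.
    rewrite /T integral0_eq ?mule0// => x xz; congr EFin; apply: tlog_eq0 => //.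
    have := FL x z; rewrite Fz subr0 => /le_trans; apply.
    rewrite ler_pM2l//; apply: rV_norm_le; first exact: ltW.
    by move=> i; rewrite mxE [X in _ + X]mxE; exact: xz.
  have := le_trans (lower _ tau0) (start _ tau0).
  move=> /le_trans /(_ (leeD (steps _ m tau0) (lexx K%:E))).
  rewrite T0 add0e -EFinD lee_fin; congr (_ <= _).
  rewrite (_ : mu0 / tau = mu0 / (L * rho) * 2 ^+ (k0 + m)).
    have c0 : 0 < mu0 / (L * rho) by apply: divr_gt0 => //; exact: mulr_gt0.
    have p0 : 0 < 2 ^+ (k0 + m) :> R by rewrite exprn_gt0.
    by rewrite lnM ?posrE// lnXn// mulr_natl.
  rewrite /tau /rad; field.
  by rewrite expf_neq0//= !gt_eqF.
(* In [bound] the left side grows by [ln 2] per step and the right side by half of that, so this [m]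
   violates it. *)
pose m := (Num.truncn ((K - lnc) / (ln 2 / 2))).+1.
have : (K - lnc) / (ln 2 / 2) < m%:R by exact: truncnS_gt.
rewrite ltr_pdivrMr ?divr_gt0// => Km.
have := bound m; rewrite natrD mulrDl.
have k0ln : 0 <= k0%:R * ln (2 : R) by apply: mulr_ge0 => //; exact: ltW.
lra.
Qed.
End core.

(** * Localization *)

(** The integral of a nonnegative function is the supremum of the integrals of the
    simple functions below it, so no measurability is needed; it is not available
    for the gradient of a function that is arbitrary outside [Omega]. *)
Lemma ge0_le_integral_lower d (T : measurableType d) (R : realType)
    (m : {measure set T -> \bar R}) (f g : T -> \bar R) :
  (forall x, 0 <= f x)%E -> (forall x, f x <= g x)%E ->
  (\int[m]_x f x <= \int[m]_x g x)%E.
Proof.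
move=> f0 fg; rewrite ge0_integralTE// [leRHS]ge0_integralTE; last first.
  by move=> x; exact: le_trans (f0 x) (fg x).
apply: ge_ereal_sup => _ [h hf <-]; apply: ereal_sup_ubound.
by exists h => // x; exact: le_trans (hf x) (fg x).
Qed.

Lemma coord_le_euclidean_norm (R : realType) n (v : 'rV[R]_n) i :
  `|v ord0 i| <= euclidean_norm v.
Proof.
rewrite -sqrtr_sqr ler_wsqrtr// (bigD1 i)//= lerDl.
by apply: sumr_ge0 => j _; exact: sqr_ge0.
Qed.

Section localization.
Context {R : realType} (n : nat) (Omega : set 'rV[R]_n) (f : 'rV[R]_n -> R).
Hypotheses (Omega_open : open Omega)
  (f_lip : [locally [lipschitz f x | x in Omega]]).

Lemma locally_lipschitz_ball z : Omega z ->
  exists L r, [/\ 0 < L, 0 < r, ball z r `<=` Omega &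
    forall x y, ball z r x -> ball z r y -> `|f x - f y| <= L * `|x - y|].
Proof.
(* The hypothesis concerns pairs of points; at the diagonal point [(z, z)] it gives a product
   neighbourhood, and a ball inside both factors serves. Any constant above [N] works, and
   [Num.max N 0 + 1] is also positive. *)
move=> Oz; have [N [_ NP]] := @f_lip (z, z) (conj Oz Oz).
have /NP : N < Num.max N 0 + 1.
  by rewrite (@le_lt_trans _ _ (Num.max N 0)) ?le_max ?lexx// ltrDl.
set L := _ + 1; rewrite /dominated_by /= => -[[A B] /= [zA zB] AB].
have : nbhs z (A `&` B `&` Omega).
  by apply: filterI; [exact: filterI|exact: open_nbhs_nbhs].
move=> /nbhs_ballP[r /= r0 rAB].
exists L, r; split => //.
- by rewrite /L ltr_wpDl// le_max lexx orbT.
- by move=> x /rAB[].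
- move=> x y /rAB[[Ax Bx] Ox] /rAB[[Ay By] Oy].
  exact: (AB (x, y) (conj Ax By) (conj Ox Oy)).
Qed.

Lemma locally_lipschitz_continuous z : Omega z -> {for z, continuous f}.
Proof.
move=> /locally_lipschitz_ball[L [r [L0 r0 _ fL]]].
exact: lipschitz_ball_continuous fL.
Qed.

(** Otherwise the zero set would be open, and it is closed in [Omega] by continuity. By
    connectedness it would contain the component of [x0], on which [f] would be constant. *)
Lemma zero_near_nonzero x0 : zero_set Omega f x0 ->
  nonconstant_on (connected_component Omega x0) f ->
  exists z, [/\ Omega z, f z = 0 & forall r, 0 < r -> exists2 a, ball z r a & f a != 0].
Proof.
move=> [Ox0 fx0] [x [y [Cx Cy fxy]]]; apply: contrapT => nz.
pose C := connected_component Omega x0.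
have CO : C `<=` Omega by exact: connected_component_sub.
pose Z := [set u | Omega u /\ f u = 0].
have oZ : open Z.
  rewrite openE => u [Ou fu].
  have [r r0 ra] : exists2 r, 0 < r & forall a, ball u r a -> f a = 0.
    apply: contrapT => nr; apply: nz; exists u; split => // r r0.
    apply: contrapT => na; apply: nr; exists r => // a ua.
    by apply/eqP; apply: contrapT => /negP fa; apply: na; exists a.
  have uO : nbhs u Omega by exact: open_nbhs_nbhs.
  apply: filterS2 uO (nbhsx_ballx u r r0) => v Ov uv; split => //.
  exact: ra.
have oN : open [set u | Omega u /\ f u != 0].
  rewrite openE => u [Ou fu].
  have uO : nbhs u Omega by exact: open_nbhs_nbhs.
  have fN : nbhs u (fun v => f v != 0).
    have := near_sg (locally_lipschitz_continuous Ou) fu.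
    apply: filterS => v fuv; apply: contraNneq fu => fv.
    by rewrite -sgr_eq0 -fuv fv sgr0.
  exact: filterS2 uO fN.
suff CZ : C `&` Z = C.
  apply: fxy; have : (C `&` Z) x by rewrite CZ.
  have : (C `&` Z) y by rewrite CZ.
  by move=> [_ [_ ->]] [_ [_ ->]].
apply: (@component_connected _ Omega x0).
- by exists x0; split; [exact: connected_component_refl|split].
- by exists Z.
- exists (~` [set u | Omega u /\ f u != 0]); first exact: open_closedC.
  apply/seteqP; split => u [Cu].
    by move=> [Ou fu]; split => // -[_]; rewrite fu eqxx.
  move=> nfu; split => //; split; first exact: CO.
  by apply/eqP; apply: contrapT => fu; apply: nfu; split; [exact: CO|exact/negP].
Qed.

(** [f \o clamp z rho] agrees with [f] on the cube and is Lipschitz everywhere. *)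
Let clamp (z : 'rV[R]_n) (rho : R) (x : 'rV[R]_n) : 'rV[R]_n :=
  \row_i Num.max (z ord0 i - rho) (Num.min (z ord0 i + rho) (x ord0 i)).

Let clamp_cube z rho x : 0 <= rho -> cube z rho (clamp z rho x).
Proof.
move=> rho0 i; rewrite mxE ler_norml /Num.max /Num.min.
by case: ifPn; case: ifPn; rewrite -?leNgt; lra.
Qed.

Let clamp_id z rho x : cube z rho x -> clamp z rho x = x.
Proof.
move=> xz; apply/rowP => i; rewrite mxE; have := xz i; rewrite ler_norml /Num.max /Num.min.
by case: ifPn; case: ifPn; rewrite -?leNgt; lra.
Qed.

Let clamp_lip z rho x y : 0 <= rho -> `|clamp z rho x - clamp z rho y| <= `|x - y|.
Proof.
move=> rho0; apply: rV_norm_le => // i.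
have := ler_coord_norm (x - y) i; rewrite !mxE.
have [|] := leP (x ord0 i) (y ord0 i) => xy h.
  apply: le_trans h; rewrite ler_norml !(ler0_norm, ltr0_norm) ?subr_le0// /Num.max /Num.min.
  by do !case: ifPn; rewrite -?leNgt; lra.
apply: le_trans h; rewrite ler_norml !(ger0_norm, gtr0_norm) ?subr_ge0 ?(ltW xy)//.
rewrite /Num.max /Num.min.
by do !case: ifPn; rewrite -?leNgt; lra.
Qed.

(** The field [X] stands for either gradient of the theorem, so that both integrals are treated at
    once. *)
Lemma log_gradient_infinite x0 (X : 'rV[R]_n -> 'rV[R]_n) :
  zero_set Omega f x0 ->
  nonconstant_on (connected_component Omega x0) f ->
  (forall x i, Omega x -> f x != 0 ->
    `|'D_(delta_mx ord0 i) f x / f x| <= `|X x ord0 i|) ->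
  (\int[mu n]_(x in Omega `\` zero_set Omega f) (euclidean_norm (X x) ^+ n)%:E)%E = +oo%E.
Proof.
move=> zx0 ncf XD.
have [z [Oz fz za]] := zero_near_nonzero zx0 ncf.
have [L [r [L0 r0 rO fL]]] := locally_lipschitz_ball Oz.
(* The cube of radius [2 * rho] lies in the ball where [f] is Lipschitz. Clamping to it, rather than
   to radius [rho], makes [F] equal to [f] near every point of [cube z rho], so that their
   derivatives agree there. *)
pose rho := r / 3; have rho0 : 0 < rho by rewrite divr_gt0.
pose F x := f (clamp z (2 * rho) x).
have rho20 : 0 <= 2 * rho by rewrite mulr_ge0// ltW.
have cube_ball s t : 0 <= s -> s < t -> cube z s `<=` ball z t.
  move=> s0 st x xz; rewrite mx_norm_ball /ball_ /= (le_lt_trans _ st)//.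
  by apply: rV_norm_le => // i; rewrite mxE [X in _ + X]mxE distrC.
have cr x : cube z (2 * rho) x -> ball z r x.
  by apply: cube_ball => //; rewrite /rho; lra.
have FL x y : `|F x - F y| <= L * `|x - y|.
  apply: (le_trans (fL _ _ (cr _ (clamp_cube _ _ rho20)) (cr _ (clamp_cube _ _ rho20)))).
  by rewrite ler_pM2l// clamp_lip.
have Ff x : cube z (2 * rho) x -> F x = f x by move=> xz; rewrite /F clamp_id.
have cube12 : cube z rho `<=` cube z (2 * rho).
  by apply: sub_cube => i; rewrite subrr normr0; lra.
have Fz : F z = 0.
  by rewrite Ff// => i; rewrite subrr normr0.
have [a zaB fa] := za _ rho0.
have az i : `|a ord0 i - z ord0 i| < rho.
  by move: zaB => [_ /(_ ord0 i)]; rewrite /ball/= distrC.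
have Fa : F a != 0.
  by rewrite Ff// => i; apply: (le_trans (ltW (az i))); lra.
(* In dimension 0 the points [a] and [z] would coincide. *)
have n0 : (0 < n)%N.
  rewrite lt0n; apply/negP => /eqP n0; move: fa; suff -> : a = z by rewrite fz eqxx.
  by apply/rowP => i; have := ltn_ord i; rewrite [X in (_ < X)%N]n0.
have := log_gradient_integral_infinite n0 L0 FL rho0 Fz Fa az.
pose G x := \sum_(i < n) `|'D_(delta_mx ord0 i) F x / F x| ^+ n; rewrite -/(G _) => GE.
have G0 x : 0 <= G x by apply: sumr_ge0 => i _; rewrite exprn_ge0.
have near_Ff x : cube z rho x -> \forall y \near x, F y = f y.
  move=> xz; apply/nbhs_ballP; exists rho => // y [_ xy].
  apply: Ff => i; rewrite (le_trans (ler_distD (x ord0 i) _ _))//.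
  have := xz i; have := ltW (xy ord0 i); rewrite distrC; lra.
have GX x : Omega x -> f x != 0 -> cube z rho x -> n%:R^-1 * G x <= euclidean_norm (X x) ^+ n.
  move=> Ox fx xz; rewrite ler_pdivrMl ?ltr0n// mulr_natl.
  rewrite -[n in _ *+ n]card_ord -sumr_const; apply: ler_sum => i _.
  rewrite lerXn2r ?nnegrE// ?sqrtr_ge0//.
  rewrite (near_eq_derive _ (near_Ff _ xz)) Ff; last exact: cube12.
  exact: le_trans (XD _ _ Ox fx) (coord_le_euclidean_norm _ _).
have mC : measurable (cube z rho) by exact: measurable_cube.
have cF : continuous F by exact: (lipschitz_continuous (V := 'rV[R]_n)) FL.
have mG : measurable_fun (cube z rho) (EFin \o G).
  apply/measurable_EFinP; apply: measurable_funTS.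
  exact: measurable_log_gradient_power FL.
apply/eqP; rewrite eq_le leey/= integral_mkcond.
apply: (@le_trans _ _ (\int[mu n]_x ((fun x => (n%:R^-1)%:E * (G x)%:E)%E \_ (cube z rho)) x)%E).
  rewrite -integral_mkcond ge0_integralZl_EFin//.
    by rewrite GE gt0_muley// lte_fin invr_gt0 ltr0n.
  by move=> x _; rewrite lee_fin.
apply: ge0_le_integral_lower => x; rewrite !patchE; case: ifPn => // xC.
  by rewrite -EFinM lee_fin mulr_ge0.
have xz : cube z rho x by rewrite inE in xC.
have Ox : Omega x by exact/rO/cr/cube12.
case: ifPn => xE.
  rewrite -EFinM lee_fin; apply: GX => //.
  move: xE; rewrite inE => -[_ nZ]; apply: contra_not_neq nZ => fx.
  by split.
(* The zeros of [f] in the cube are outside the domain of integration, and there [G] is 0 because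
   division by 0 gives 0. *)
suff -> : G x = 0 by rewrite mule0.
apply: big1 => i _; rewrite Ff; last exact: cube12.
suff -> : f x = 0 by rewrite invr0 mulr0 normr0 expr0n eqn0Ngt n0.
apply/eqP; apply: contraNT xE => fx; rewrite inE; split => //.
by move=> [_ fx0]; rewrite fx0 eqxx in fx.
by case: ifP => _ //; rewrite lee_fin exprn_ge0// sqrtr_ge0.
Qed.

End localization.

Unset Implicit Arguments.
Set Strict Implicit.

(* A function Omega -> R is given by a total f; only its values on the open
   set Omega matter.

   Non-constancy is required on the connected component of Omega at some zero
   x0 of f; for connected Omega it is non-constancy on Omega, by
   connected_component_id. Non-constancy on a disconnected Omega alone would
   not do: f = 0 on one component and f = 1 on another. *)
Theorem theorem1p2 (R : realType) (n : nat) (Omega : set 'rV[R]_n)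
    (f : 'rV[R]_n -> R)
    (Omega_open : open Omega)
    (f_locally_lipschitz : [locally [lipschitz f x | x in Omega]])
    (x0 : 'rV[R]_n) (x0_zero : zero_set Omega f x0)
    (f_nonconstant : nonconstant_on (connected_component Omega x0) f) :
  (\int[lebesgue_measure_rV n]_(x in Omega `\` zero_set Omega f)
     (euclidean_norm ((f x)^-1 *: grad f x) ^+ n)%:E)%E = +oo%E
  /\
  (\int[lebesgue_measure_rV n]_(x in Omega `\` zero_set Omega f)
     (euclidean_norm (grad (fun y => ln `|f y|) x) ^+ n)%:E)%E = +oo%E.
Proof.
split; apply: (log_gradient_infinite Omega_open f_locally_lipschitz x0_zero f_nonconstant).
  by move=> x i Ox fx; rewrite [X in _ <= `|X|]mxE [X in _ <= `|_ * X|]mxE mulrC.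
move=> x i Ox fx; rewrite mxE; apply: derive_ln_norm_ge => //.
exact: locally_lipschitz_continuous Ox.
Qed.
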